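(* The category $\mathcal{F}_\pi$ is a Krull-Schmidt category with indecomposable objects isomorphic to $E(x,y)$ for some $0\le x\le y<2\pi$.
   Context: $R$ is a discrete valuation ring with uniformizing parameter $t$. $S^1=\mathbb{R}/2\pi\mathbb{Z}$, and for $x\in\mathbb{R}$ the class of $x$ in $S^1$ is $[x]$. A representation $V$ of $S^1$ over $R$ consists of an $R$-module $V[x]$ for every $[x]\in S^1$ and an $R$-linear map $V^{(x,\alpha)}:V[x]\to V[x-\alpha]$ for every $[x]\in S^1$ and real $\alpha\ge 0$ (depending only on $[x]$ and $\alpha$), such that $V^{(x-\beta,\alpha)}\circ V^{(x,\beta)}=V^{(x,\alpha+\beta)}$ for all $\alpha,\beta\ge 0$, and $V^{(x,2\pi n)}:V[x]\to V[x]$ is multiplication by $t^n$ for all $n\in\mathbb{N}$. A morphism $f:V\to W$ is a family of $R$-linear maps $f_{[x]}:V[x]\to W[x]$ with $W^{(x,\alpha)}f_{[x]}=f_{[x-\alpha]}V^{(x,\alpha)}$. Monomorphisms, epimorphisms, exactness and direct sums are taken pointwise; a representation is projective if morphisms from it lift through all epimorphisms. $P_{[x]}$ is the representation with $P_{[x]}[x-\alpha]=Re_x^\alpha$ free on one generator $e_x^\alpha$ for $0\le\alpha<2\pi$; for $n\in\mathbb{N}$ put $e_x^{\gamma+2\pi n}:=t^ne_x^\gamma$; write $e_x=e_x^0$; the structure maps are $P_{[x]}^{(x-\alpha,\beta)}(e_x^\alpha)=e_x^{\alpha+\beta}$. A representation is finitely generated if it is a quotient of a finite direct sum of representations $P_{[x_i]}$.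 $\mathcal{P}_{S^1}$ is the category of all finitely generated projective representations of $S^1$ over $R$. The category $\mathcal{F}_\pi$: objects are pairs $(V,d)$ with $V\in\mathcal{P}_{S^1}$ and $d:V\to V$ an endomorphism with $d^2=t$ (multiplication by $t$); morphisms $(V,d)\to(W,d)$ are morphisms $f:V\to W$ with $fd=df$. For real numbers $x\le y\le x+2\pi$ put $\alpha=y-x$, $\beta=x+2\pi-y$ and $E(x,y)=\left(P_{[x]}\oplus P_{[y]},\ d=\begin{bmatrix}0&\beta_*\\ \alpha_*&0\end{bmatrix}\right)\in\mathcal{F}_\pi$, where $\alpha_*:P_{[x]}\to P_{[y]}$ is the morphism with $\alpha_*(e_x)=e_y^\alpha$ and $\beta_*:P_{[y]}\to P_{[x]}$ is the morphism with $\beta_*(e_y)=e_x^\beta$. A Krull-Schmidt category is an additive category in which every object is a finite direct sum of objects with local endomorphism rings. *)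

(* Defs.v *)
From HB Require Import structures.
From mathcomp Require Import all_boot all_order all_algebra.
From mathcomp Require Import archimedean ring_quotient generic_quotient.
From mathcomp Require Import boolp reals trigo.
From mathcomp Require Import zify lra.

Set Implicit Arguments.
Unset Strict Implicit.
Unset Printing Implicit Defensive.

Import Order.TTheory GRing.Theory Num.Theory.
Local Open Scope ring_scope.
Local Open Scope quotient_scope.

(* [idealr_closed] only accepts proper ideals; the unit ideal is principal
   anyway, and maximal ideals are proper. *)
Section DiscreteValuationRings.
Variable R : idomainType.

Definition generates (a : R) (I : {pred R}) : Prop :=
  forall x, x \in I <-> exists b, x = b * a.

Definition principal_ideal_ring : Prop :=
  forall I : {pred R}, idealr_closed I -> exists a, generates a I.

Definition maximal_ideal (I : {pred R}) : Prop :=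
  idealr_closed I /\
  forall J : {pred R}, idealr_closed J -> {subset I <= J} -> {subset J <= I}.

Definition is_dvr : Prop :=
  principal_ideal_ring /\
  exists M : {pred R},
    [/\ maximal_ideal M,
        forall J, maximal_ideal J -> J =i M
      & exists2 x, x \in M & x != 0].

Definition uniformizer (t : R) : Prop :=
  forall M, maximal_ideal M -> generates t M.

End DiscreteValuationRings.

(* Morphism equality is Leibniz equality of bundled linear maps. *)
Lemma linear_eq (R : pzRingType) (U V : lmodType R) (f g : {linear U -> V}) :
  f =1 g -> f = g.
Proof.
case: f g => [f [[?] [?]]] [g [[?] [?]]] /= /funext efg.
by subst g; do 3! f_equal; apply: Prop_irrelevance.
Qed.

Record preadditive := Preadditive {
  ob :> Type;
  hom : ob -> ob -> zmodType;
  idm : forall X, hom X X;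
  compm : forall X Y Z, hom Y Z -> hom X Y -> hom X Z;
  compmA : forall X Y Z W (h : hom Z W) (g : hom Y Z) (f : hom X Y),
    compm h (compm g f) = compm (compm h g) f;
  comp1m : forall X Y (f : hom X Y), compm (idm Y) f = f;
  compm1 : forall X Y (f : hom X Y), compm f (idm X) = f;
  compmDl : forall X Y Z (g1 g2 : hom Y Z) (f : hom X Y),
    compm (g1 + g2) f = compm g1 f + compm g2 f;
  compmDr : forall X Y Z (g : hom Y Z) (f1 f2 : hom X Y),
    compm g (f1 + f2) = compm g f1 + compm g f2
}.
Arguments idm {p}.
Arguments compm {p X Y Z}.

Section KrullSchmidt.
Variable C : preadditive.

Definition is_zero_object (Z : C) : Prop :=
  forall X : C, (forall f g : hom X Z, f = g) /\ (forall f g : hom Z X, f = g).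

Definition is_iso (X Y : C) (f : hom X Y) : Prop :=
  exists g : hom Y X, compm g f = idm X /\ compm f g = idm Y.

Definition isomorphic (X Y : C) : Prop := exists f : hom X Y, is_iso f.

Definition is_direct_sum (I : finType) (X : I -> C) (S : C) : Prop :=
  exists (inj : forall i, hom (X i) S) (proj : forall i, hom S (X i)),
    [/\ forall i, compm (proj i) (inj i) = idm (X i),
        forall i j, i != j -> compm (proj j) (inj i) = 0
      & \sum_(i : I) compm (inj i) (proj i) = idm S].

(* The empty family provides a zero object. *)
Definition additive_category : Prop :=
  forall n (X : 'I_n -> C), exists S : C, is_direct_sum X S.

Definition local_endomorphism_ring (X : C) : Prop :=
  idm X <> 0 /\
  forall f g : hom X X, ~ is_iso f -> ~ is_iso g -> ~ is_iso (f + g).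

Definition krull_schmidt : Prop :=
  additive_category /\
  forall X : C, exists n (Y : 'I_n -> C),
    is_direct_sum Y X /\ forall i, local_endomorphism_ring (Y i).

Definition indecomposable (X : C) : Prop :=
  ~ is_zero_object X /\
  forall Y : bool -> C, is_direct_sum Y X ->
    is_zero_object (Y true) \/ is_zero_object (Y false).

End KrullSchmidt.

Section Circle.
Variable RR : realType.

Definition two_pi_Z : {pred RR} := fun x => x / (2 * pi) \is a Num.int.

Lemma two_pi_ZE x : (x \in two_pi_Z) = (x / (2 * pi) \is a Num.int).
Proof. by []. Qed.

Fact two_pi_Z_zmod_closed : zmod_closed two_pi_Z.
Proof.
split=> [|x y]; rewrite !two_pi_ZE ?mul0r ?rpred0 // => hx hy.
by rewrite mulrBl rpredB.
Qed.

HB.instance Definition _ :=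
  GRing.isZmodClosed.Build RR two_pi_Z two_pi_Z_zmod_closed.

Definition S1 := Quotient.quot two_pi_Z.
HB.instance Definition _ := GRing.Zmodule.on S1.

Definition cls (x : RR) : S1 := \pi_S1 x.

Lemma clsB x y : cls (x - y) = cls x - cls y.
Proof. by rewrite /cls !piE. Qed.

Lemma clsD x y : cls (x + y) = cls x + cls y.
Proof. by rewrite /cls !piE. Qed.

Lemma cls_eq x y : (cls x == cls y) = ((x - y) / (2 * pi) \is a Num.int).
Proof. by rewrite /cls piE. Qed.

Lemma cls_repr (s : S1) : cls (repr s) = s.
Proof. exact: reprK. Qed.


Lemma cls_turns (n : nat) : cls (2 * pi * n%:R) = 0.
Proof.
apply/eqP; rewrite -(subrr (cls 0)) -clsB subrr cls_eq subr0 mulrAC divff.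
  by rewrite mul1r rpred_nat.
by rewrite mulf_neq0 ?pnatr_eq0 // gt_eqF // pi_gt0.
Qed.

(* [step s a s'] says that rotating [s] clockwise by [a >= 0] ends at [s']. *)
Definition step (s : S1) (a : RR) (s' : S1) : bool :=
  (0 <= a) && (s' == s - cls a).

Lemma step_trans s a s' b s'' :
  step s a s' -> step s' b s'' -> step s (a + b) s''.
Proof.
move=> /andP[a0 /eqP->] /andP[b0 /eqP->].
by rewrite /step addr_ge0 //= clsD opprD addrA.
Qed.

Lemma step_turns s (n : nat) : step s (2 * pi * n%:R) s.
Proof.
by rewrite /step cls_turns subr0 eqxx !mulr_ge0 // ltW // pi_gt0.
Qed.

Definition turns (a : RR) : nat := Num.truncn (a / (2 * pi)).

(* The representative in [0, 2 pi) of the class [s - s']. *)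
Definition angle (s s' : S1) : RR :=
  let x := repr (s - s') in x - 2 * pi * (Num.floor (x / (2 * pi)))%:~R.

Let tp_gt0 : 0 < 2 * pi :> RR.
Proof. by rewrite mulr_gt0 // pi_gt0. Qed.

Let tp_neq0 : 2 * pi != 0 :> RR.
Proof. by rewrite gt_eqF. Qed.

Lemma angle_itv s s' : 0 <= angle s s' < 2 * pi.
Proof.
rewrite /angle; set x := repr _; set m := (Num.floor _)%:~R.
have /andP[h1 h2] := floor_itv (x / (2 * pi)).
rewrite subr_ge0 mulrC -ler_pdivlMr // h1 /=.
move: h2; rewrite ltr_pdivrMr // intrD -/m mulrDl mul1r => h2.
by rewrite ltrBlDr addrC.
Qed.

Lemma cls_angle s s' : cls (angle s s') = s - s'.
Proof.
rewrite -[RHS]cls_repr; apply/eqP; rewrite cls_eq /angle.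
rewrite addrAC subrr sub0r mulNr rpredN mulrAC divff // mul1r.
exact: rpred_int.
Qed.

Lemma step_angle s s' : step s (angle s s') s'.
Proof.
have /andP[h _] := angle_itv s s'.
by rewrite /step h cls_angle opprB addrC subrK eqxx.
Qed.

Lemma angle_uniq s s' a : step s a s' -> a < 2 * pi -> a = angle s s'.
Proof.
move=> /andP[a0 /eqP es] a2.
have /andP[b0 b2] := angle_itv s s'.
have: cls a == cls (angle s s') by rewrite cls_angle es opprB addrC subrK.
rewrite cls_eq => /intrP[m em].
have eam : a - angle s s' = m%:~R * (2 * pi) by rewrite -em mulfVK.
suff m0 : m = 0 by apply/eqP; rewrite -subr_eq0 eam m0 mul0r.
have h1 : m%:~R * (2 * pi) < 1 * (2 * pi) :> RR by rewrite -eam; lra.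
have h2 : (-1) * (2 * pi) < m%:~R * (2 * pi) :> RR by rewrite -eam; lra.
rewrite ltr_pM2r // in h1; rewrite ltr_pM2r // in h2.
have h1' : m%:~R < (1 : int)%:~R :> RR by [].
have h2' : (-1 : int)%:~R < m%:~R :> RR by rewrite mulrNz.
rewrite ltr_int in h1'; rewrite ltr_int in h2'; lia.
Qed.

Lemma step_angleE s s' a : step s a s' ->
  a = angle s s' + 2 * pi * (turns a)%:R.
Proof.
move=> h; have /andP[a0 /eqP es] := h.
have q0 : 0 <= a / (2 * pi) by rewrite divr_ge0 // ltW.
have /andP[h1 h2] := truncn_itv q0.
rewrite -(@angle_uniq s s' (a - 2 * pi * (turns a)%:R)) ?subrK //.
  rewrite /step subr_ge0 mulrC -ler_pdivlMr // h1 /=.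
  by rewrite mulrC clsB cls_turns subr0 es.
move: h2; rewrite ltr_pdivrMr // -natr1 mulrDl mul1r => h2.
by rewrite ltrBlDr addrC [2 * pi * _]mulrC.
Qed.

Lemma turnsD a n : 0 <= a -> turns (a + 2 * pi * n%:R) = (turns a + n)%N.
Proof.
move=> a0; rewrite /turns mulrDl [_ * n%:R / _]mulrAC divff // mul1r addrC.
have an : a / (2 * pi) \is Num.nneg by rewrite nnegrE divr_ge0 // ltW.
by rewrite truncnD ?natr_nat // natrK addnC.
Qed.

Lemma turns_lt a : 0 <= a < 2 * pi -> turns a = 0%N.
Proof.
move=> /andP[a0 a2]; apply/truncn0Pn.
by rewrite -ltNge ltr_pdivrMr // mul1r.
Qed.

Lemma angleD s s1 s2 b : step s1 b s2 ->
  angle s s1 + b = angle s s2 + 2 * pi * (turns (angle s s1 + b))%:R.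
Proof. by move=> h; apply: step_angleE (step_trans (step_angle s s1) h). Qed.

Lemma turns_angleD s s1 s2 a b : step s1 b s2 -> 0 <= a ->
  turns (angle s s1 + (a + b)) =
  (turns (angle s s1 + b) + turns (angle s s2 + a))%N.
Proof.
move=> h a0; have E := angleD s h.
have /andP[c0 _] := angle_itv s s2.
set n := turns (angle s s1 + b) in E *.
have -> : angle s s1 + (a + b) = angle s s2 + a + 2 * pi * n%:R.
  by rewrite [RHS]addrAC -E -[RHS]addrA [b + a]addrC.
by rewrite addnC turnsD //; exact: addr_ge0.
Qed.

End Circle.
Arguments cls {RR}.
Arguments angle {RR}.
Arguments turns {RR}.
Arguments step {RR}.

Section Representations.
Variables (RR : realType) (R : comNzRingType) (t : R).
Local Notation S1 := (S1 RR).

(* The target of the structure map is any [s'] provably equal to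
   [s - cls a], which avoids transporting between such modules. *)
Record rep := Rep {
  rep_mod :> S1 -> lmodType R;
  rep_map : forall s s' a, step s a s' -> {linear rep_mod s -> rep_mod s'};
  rep_mapD : forall s s' s'' a b (h : step s b s') (h' : step s' a s'')
      (h'' : step s (a + b) s'') v,
    rep_map h' (rep_map h v) = rep_map h'' v;
  rep_map_turns : forall s n (h : step s (2 * pi * n%:R) s) v,
    rep_map h v = t ^+ n *: v
}.

Arguments rep_map _ {s s' a} h.

Lemma rep_map_eq (V : rep) s s' a b (h : step s a s') (h' : step s b s') v :
  a = b -> rep_map V h v = rep_map V h' v.
Proof. by move=> ab; subst b; rewrite (bool_irrelevance h h'). Qed.

Lemma rep_map0 (V : rep) s (h : step s 0 s) v : rep_map V h v = v.
Proof.
have h0 : step s (2 * pi * 0%:R) s := step_turns s 0.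
by rewrite (rep_map_eq h h0) ?mulr0 // rep_map_turns scale1r.
Qed.

Record rhom (V W : rep) := RHom {
  rhom_fun :> forall s, {linear V s -> W s};
  rhom_comm : forall s s' a (h : step s a s') v,
    rep_map W h (rhom_fun s v) = rhom_fun s' (rep_map V h v)
}.

Lemma rhom_eq V W (f g : rhom V W) : (forall s, f s =1 g s) -> f = g.
Proof.
case: f g => [f fP] [g gP] /= fg.
have {}fg : f = g.
  by apply: functional_extensionality_dep => s; apply/linear_eq/fg.
by subst g; f_equal; apply: Prop_irrelevance.
Qed.

HB.instance Definition _ V W := gen_eqMixin (rhom V W).
HB.instance Definition _ V W := gen_choiceMixin (rhom V W).

Section RHomZmodule.
Variables V W : rep.
Implicit Types f g : rhom V W.

Fact rhom_zero_comm s s' a (h : step s a s') v :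
  rep_map W h ((\0 : {linear V s -> W s}) v) =
  (\0 : {linear V s' -> W s'}) (rep_map V h v).
Proof. by rewrite /= linear0. Qed.
Definition rhom_zero := RHom rhom_zero_comm.

Fact rhom_add_comm f g s s' a (h : step s a s') v :
  rep_map W h ((f s \+ g s : {linear V s -> W s}) v) =
  (f s' \+ g s' : {linear V s' -> W s'}) (rep_map V h v).
Proof. by rewrite /= linearD !rhom_comm. Qed.
Definition rhom_add f g := RHom (rhom_add_comm f g).

Fact rhom_opp_comm f s s' a (h : step s a s') v :
  rep_map W h ((\- (f s) : {linear V s -> W s}) v) =
  (\- (f s') : {linear V s' -> W s'}) (rep_map V h v).
Proof. by rewrite /= linearN !rhom_comm. Qed.
Definition rhom_opp f := RHom (rhom_opp_comm f).

Fact rhom_addA : associative rhom_add.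
Proof. by move=> f g h; apply: rhom_eq => s v /=; rewrite addrA. Qed.
Fact rhom_addC : commutative rhom_add.
Proof. by move=> f g; apply: rhom_eq => s v /=; rewrite addrC. Qed.
Fact rhom_add0 : left_id rhom_zero rhom_add.
Proof. by move=> f; apply: rhom_eq => s v /=; rewrite add0r. Qed.
Fact rhom_addN : left_inverse rhom_zero rhom_opp rhom_add.
Proof. by move=> f; apply: rhom_eq => s v /=; rewrite addNr. Qed.

HB.instance Definition _ := GRing.isZmodule.Build (rhom V W)
  rhom_addA rhom_addC rhom_add0 rhom_addN.

End RHomZmodule.

Fact rhom_id_comm (V : rep) s s' a (h : step s a s') v :
  rep_map V h ((idfun : {linear V s -> V s}) v) =
  (idfun : {linear V s' -> V s'}) (rep_map V h v).
Proof. by []. Qed.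
Definition rhom_id V := RHom (@rhom_id_comm V).

Fact rhom_comp_comm U V W (g : rhom V W) (f : rhom U V)
    s s' a (h : step s a s') v :
  rep_map W h ((g s \o f s : {linear U s -> W s}) v) =
  (g s' \o f s' : {linear U s' -> W s'}) (rep_map U h v).
Proof. by rewrite /= !rhom_comm. Qed.
Definition rhom_comp U V W (g : rhom V W) (f : rhom U V) :=
  RHom (rhom_comp_comm g f).

Definition epimorphism V W (f : rhom V W) : Prop :=
  forall s (w : W s), exists v, f s v = w.

Definition projective (P : rep) : Prop :=
  forall V W (g : rhom V W) (f : rhom P W), epimorphism g ->
    exists h : rhom P V, rhom_comp g h = f.

Definition rzero_map (s s' : S1) a (h : step s a s') : {linear 'rV[R]_0 -> 'rV[R]_0} :=
  idfun.
Fact rzero_mapD (s s' s'' : S1) a b (h : step s b s') (h' : step s' a s'')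
    (h'' : step s (a + b) s'') v :
  rzero_map h' (rzero_map h v) = rzero_map h'' v.
Proof. by []. Qed.
Fact rzero_map_turns (s : S1) n (h : step s (2 * pi * n%:R) s) v :
  rzero_map h v = t ^+ n *: v.
Proof. by rewrite [LHS]thinmx0 [RHS]thinmx0. Qed.
Definition rzero : rep :=
  @Rep (fun=> 'rV[R]_0) rzero_map rzero_mapD rzero_map_turns.

Section DirectSum.
Variables V W : rep.

Section Map.
Variables (s s' : S1) (a : RR) (h : step s a s').
Definition rsum_fun (v : V s * W s) : V s' * W s' :=
  (rep_map V h v.1, rep_map W h v.2).
Fact rsum_fun_linear : linear rsum_fun.
Proof. by move=> c u v; rewrite /rsum_fun !linearP. Qed.
HB.instance Definition _ := GRing.isLinear.Build R
  (V s * W s)%type (V s' * W s')%type _ rsum_fun rsum_fun_linear.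
Definition rsum_map : 
    {linear (V s * W s)%type -> (V s' * W s')%type} := rsum_fun.
End Map.

Fact rsum_mapD s s' s'' a b (h : step s b s') (h' : step s' a s'')
    (h'' : step s (a + b) s'') v :
  rsum_map h' (rsum_map h v) = rsum_map h'' v.
Proof. by rewrite /= /rsum_fun /= !(rep_mapD _ _ h''). Qed.
Fact rsum_map_turns s n (h : step s (2 * pi * n%:R) s) v :
  rsum_map h v = t ^+ n *: v.
Proof. by rewrite /= /rsum_fun !rep_map_turns. Qed.
Definition rsum : rep :=
  @Rep (fun s => (V s * W s)%type) rsum_map rsum_mapD rsum_map_turns.
End DirectSum.


(* [P s s'] is free on [1], which stands for e_s^a with [a = angle s s'] the
   representative of [s - s'] in [0, 2 pi).  Rotating by [b] sends it to
   e_s^(a + b) = t ^+ turns (a + b) *: e_s^(angle s s''), where [s''] is the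
   endpoint. *)
Section Free.
Variable s : S1.

Definition P_map (s1 s2 : S1) b (h : step s1 b s2) : {linear R^o -> R^o} :=
  *:%R (t ^+ turns (angle s s1 + b)).

Fact P_mapD s1 s2 s3 a b (h : step s1 b s2) (h' : step s2 a s3)
    (h'' : step s1 (a + b) s3) v :
  P_map h' (P_map h v) = P_map h'' v.
Proof.
have /andP[a0 _] := h'.
by rewrite /= (turns_angleD s h a0) exprD mulrC -scalerA.
Qed.

Fact P_map_turns s1 n (h : step s1 (2 * pi * n%:R) s1) v :
  P_map h v = t ^+ n *: v.
Proof.
have /andP[c0 _] := angle_itv s s1.
by rewrite /= turnsD // turns_lt ?angle_itv // add0n.
Qed.

Definition P : rep := @Rep (fun=> R^o) P_map P_mapD P_map_turns.

(* The element e_s^a of [P s'], for every [a >= 0] with [s'] = [s - cls a]. *)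
Definition gen (s' : S1) a (h : step s a s') : P s' := t ^+ turns a.

Lemma P_map_gen s1 s2 a b (h : step s a s1) (h' : step s1 b s2)
    (h'' : step s (a + b) s2) :
  rep_map P h' (gen h) = gen h''.
Proof.
have /andP[b0 _] := h'; have /andP[c0 _] := angle_itv s s1.
suff E : turns (a + b) = (turns (angle s s1 + b) + turns a)%N.
  by rewrite /gen /= E exprD.
have {1}-> : a = angle s s1 + 2 * pi * (turns a)%:R by exact: step_angleE.
rewrite addrAC turnsD //; exact: addr_ge0.
Qed.

(* The morphism out of [P s] sending e_s to [v]. *)
Section Lift.
Variables (V : rep) (v : V s).

Definition lift_fun (s' : S1) (r : R^o) : V s' :=
  r *: rep_map V (step_angle s s') v.
Fact lift_fun_linear s' : linear (lift_fun s').
Proof. by move=> c x y; rewrite /lift_fun scalerDl scalerA. Qed.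
HB.instance Definition _ s' := GRing.isLinear.Build R
  R^o (V s') _ (lift_fun s') (lift_fun_linear s').

Fact lift_comm s1 s2 b (h : step s1 b s2) x :
  rep_map V h ((lift_fun s1 : {linear R^o -> V s1}) x) =
  (lift_fun s2 : {linear R^o -> V s2}) (rep_map P h x).
Proof.
rewrite /= /lift_fun linearZ /= [_ *: x]mulrC -scalerA; congr (_ *: _).
have h1 := step_trans (step_angle s s1) h.
have h2 := step_turns s2 (turns (angle s s1 + b)).
rewrite -(rep_map_turns h2).
have h3 := step_trans (step_angle s s2) h2.
have h1' : step s (b + angle s s1) s2 by rewrite addrC.
have h3' : step s (2 * pi * (turns (angle s s1 + b))%:R + angle s s2) s2.
  by rewrite addrC.
rewrite (rep_mapD _ _ h1') (rep_mapD _ _ h3'); apply: rep_map_eq.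
by rewrite [RHS]addrC -(angleD s h) addrC.
Qed.
Definition lift : rhom P V := 
  @RHom P V (fun s' => lift_fun s') lift_comm.
End Lift.

Lemma angle_refl : angle s s = 0.
Proof.
apply/esym/angle_uniq; last by rewrite mulr_gt0 // pi_gt0.
by have := step_turns s 0; rewrite mulr0.
Qed.

Lemma step0 : step s 0 s.
Proof. by have := step_angle s s; rewrite angle_refl. Qed.

Lemma lift_gen (V : rep) (v : V s) : lift v s (gen step0) = v.
Proof.
rewrite /= /lift_fun /gen /turns mul0r truncn0 scale1r.
by rewrite (rep_map_eq _ step0) ?rep_map0 ?angle_refl.
Qed.

Lemma P_expand (s' : S1) (r : P s') :
  r = r *: rep_map P (step_angle s s') (gen step0).
Proof.
have h0 : step s (0 + angle s s') s' by rewrite add0r step_angle.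
rewrite (P_map_gen step0 (step_angle s s') h0).
by rewrite /gen add0r turns_lt ?angle_itv // expr0 [_ *: _]mulr1.
Qed.

Lemma P_homE (V : rep) (f : rhom P V) s' (r : P s') :
  f s' r = r *: rep_map V (step_angle s s') (f s (gen step0)).
Proof. by rewrite {1}(P_expand r) linearZ rhom_comm. Qed.

Lemma P_hom_eq (V : rep) (f g : rhom P V) :
  f s (gen step0) = g s (gen step0) -> f = g.
Proof.
move=> fg; apply: rhom_eq => s' r.
by rewrite (P_homE f) (P_homE g) fg.
Qed.

Lemma P_projective : projective P.
Proof.
move=> V W g f /(_ s (f s (gen step0)))[v gv].
by exists (lift v); apply: P_hom_eq; rewrite -gv -[in RHS](lift_gen v).
Qed.

End Free.

Lemma star_comp (s s' : S1) a b (h : step s a s') (h' : step s' b s)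
    s'' (r : P s s'') :
  a + b = 2 * pi -> lift (gen h) s'' (lift (gen h') s'' r) = t *: r.
Proof.
move=> ab.
have h2 : step s (a + b) s := step_trans h h'.
have e : gen h' = rep_map (P s') h' (gen (step0 s')).
  have h0 : step s' (0 + b) s by rewrite add0r.
  by rewrite (P_map_gen (step0 s') h' h0) /gen add0r.
have ev : lift (gen h) s (lift (gen h') s (gen (step0 s))) =
    t *: gen (step0 s).
  rewrite lift_gen e -rhom_comm lift_gen (P_map_gen h h' h2).
  rewrite /gen ab /turns mul0r truncn0 expr0 [RHS]mulr1.
  rewrite divff ?truncn1 ?expr1 //.
  by rewrite gt_eqF // mulr_gt0 // pi_gt0.
have -> : lift (gen h) s'' (lift (gen h') s'' r) =
    rhom_comp (lift (gen h)) (lift (gen h')) s'' r by [].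
rewrite P_homE.
have -> : rhom_comp (lift (gen h)) (lift (gen h')) s (gen (step0 s)) =
    t *: gen (step0 s) by [].
rewrite [rep_map _ _ _]linearZ [RHS](congr1 (fun u => t *: u) (P_expand r)).
by rewrite !scalerA [r * t]mulrC.
Qed.

Definition finitely_generated (V : rep) : Prop :=
  exists (xs : seq S1) (f : rhom (foldr (fun x => rsum (P x)) rzero xs) V),
    epimorphism f.

Section RSumHom.
Variables V W : rep.

Definition rinl_fun s (v : V s) : rsum V W s := (v, 0).
Fact rinl_linear s : linear (@rinl_fun s).
Proof. by move=> c u v; congr (_, _); rewrite /= scaler0 addr0. Qed.
HB.instance Definition _ s := GRing.isLinear.Build R
  (V s) (rsum V W s) _ (@rinl_fun s) (@rinl_linear s).

Definition rinr_fun s (w : W s) : rsum V W s := (0, w).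
Fact rinr_linear s : linear (@rinr_fun s).
Proof. by move=> c u v; congr (_, _); rewrite /= scaler0 addr0. Qed.
HB.instance Definition _ s := GRing.isLinear.Build R
  (W s) (rsum V W s) _ (@rinr_fun s) (@rinr_linear s).

Definition rfst_fun s (v : rsum V W s) : V s := v.1.
Fact rfst_linear s : linear (@rfst_fun s).
Proof. by []. Qed.
HB.instance Definition _ s := GRing.isLinear.Build R
  (rsum V W s) (V s) _ (@rfst_fun s) (@rfst_linear s).

Definition rsnd_fun s (v : rsum V W s) : W s := v.2.
Fact rsnd_linear s : linear (@rsnd_fun s).
Proof. by []. Qed.
HB.instance Definition _ s := GRing.isLinear.Build R
  (rsum V W s) (W s) _ (@rsnd_fun s) (@rsnd_linear s).

Fact rinl_comm s s' a (h : step s a s') v :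
  rep_map (rsum V W) h ((@rinl_fun s : {linear _ -> _}) v) =
  (@rinl_fun s' : {linear _ -> _}) (rep_map V h v).
Proof. by rewrite /= /rinl_fun /rsum_fun /= linear0. Qed.
Definition rinl : rhom V (rsum V W) := RHom rinl_comm.

Fact rinr_comm s s' a (h : step s a s') v :
  rep_map (rsum V W) h ((@rinr_fun s : {linear _ -> _}) v) =
  (@rinr_fun s' : {linear _ -> _}) (rep_map W h v).
Proof. by rewrite /= /rinr_fun /rsum_fun /= linear0. Qed.
Definition rinr : rhom W (rsum V W) := RHom rinr_comm.

Fact rfst_comm s s' a (h : step s a s') v :
  rep_map V h ((@rfst_fun s : {linear _ -> _}) v) =
  (@rfst_fun s' : {linear _ -> _}) (rep_map (rsum V W) h v).
Proof. by []. Qed.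
Definition rfst : rhom (rsum V W) V := RHom rfst_comm.

Fact rsnd_comm s s' a (h : step s a s') v :
  rep_map W h ((@rsnd_fun s : {linear _ -> _}) v) =
  (@rsnd_fun s' : {linear _ -> _}) (rep_map (rsum V W) h v).
Proof. by []. Qed.
Definition rsnd : rhom (rsum V W) W := RHom rsnd_comm.

(* The endomorphism with matrix [[0, b], [a, 0]]. *)
Definition antidiag (b : rhom W V) (a : rhom V W) :
    rhom (rsum V W) (rsum V W) :=
  rhom_comp rinl (rhom_comp b rsnd) + rhom_comp rinr (rhom_comp a rfst).

Lemma antidiagE b a s (v : rsum V W s) :
  antidiag b a s v = (b s v.2, a s v.1) :> V s * W s.
Proof. by congr (_, _); rewrite /= ?addr0 ?add0r. Qed.

Lemma rsum_projective : projective V -> projective W -> projective (rsum V W).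
Proof.
move=> pV pW X Y g f eg.
have [h1 e1] := pV _ _ g (rhom_comp f rinl) eg.
have [h2 e2] := pW _ _ g (rhom_comp f rinr) eg.
exists (rhom_comp h1 rfst + rhom_comp h2 rsnd).
apply: rhom_eq => s v /=; rewrite linearD /=.
have := congr1 (fun k : rhom V Y => k s v.1) e1.
have := congr1 (fun k : rhom W Y => k s v.2) e2.
rewrite /= => -> ->; rewrite -linearD; congr (f s _).
by case: v => v w; congr (_, _); rewrite /= ?addr0 ?add0r.
Qed.

End RSumHom.

Lemma P2_finitely_generated (x y : S1) :
  finitely_generated (rsum (P x) (P y)).
Proof.
pose r := rsum (P y) rzero.
exists [:: x; y], (rhom_comp (rinl (P x) (P y)) (rfst (P x) r) +
  rhom_comp (rinr (P x) (P y))
    (rhom_comp (rfst (P y) rzero) (rsnd (P x) r))).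
move=> s w; exists (w.1, (w.2, 0)).
by case: w => v w; congr (_, _); rewrite /= ?addr0 ?add0r.
Qed.

Record Fpi_ob := FpiOb {
  Fpi_rep :> rep;
  Fpi_fg : finitely_generated Fpi_rep;
  Fpi_projective : projective Fpi_rep;
  Fpi_d : rhom Fpi_rep Fpi_rep;
  Fpi_d2 : forall s v, Fpi_d s (Fpi_d s v) = t *: v
}.

Section FpiHom.
Variables V W : Fpi_ob.

Definition d_commuting : {pred rhom V W} :=
  fun f => `[< rhom_comp f (Fpi_d V) = rhom_comp (Fpi_d W) f >].

Record Fpi_hom := FpiHom { Fpi_fun :> rhom V W; _ : Fpi_fun \in d_commuting }.

HB.instance Definition _ := [isSub for Fpi_fun].
HB.instance Definition _ := [Choice of Fpi_hom by <:].

Lemma rhom_compDl (U X Y : rep) (g1 g2 : rhom X Y) (f : rhom U X) :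
  rhom_comp (g1 + g2) f = rhom_comp g1 f + rhom_comp g2 f.
Proof. by apply: rhom_eq. Qed.
Lemma rhom_compDr (U X Y : rep) (g : rhom X Y) (f1 f2 : rhom U X) :
  rhom_comp g (f1 + f2) = rhom_comp g f1 + rhom_comp g f2.
Proof. by apply: rhom_eq => s v; rewrite /= linearD. Qed.
Lemma rhom_compNl (U X Y : rep) (g : rhom X Y) (f : rhom U X) :
  rhom_comp (- g) f = - rhom_comp g f.
Proof. by apply: rhom_eq. Qed.
Lemma rhom_compNr (U X Y : rep) (g : rhom X Y) (f : rhom U X) :
  rhom_comp g (- f) = - rhom_comp g f.
Proof. by apply: rhom_eq => s v; rewrite /= linearN. Qed.

Fact d_commuting_zmod_closed : zmod_closed d_commuting.
Proof.
split=> [|f g /asboolP cf /asboolP cg]; apply/asboolP.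
  by apply: rhom_eq => s v; rewrite /= linear0.
by rewrite rhom_compDl rhom_compDr rhom_compNl rhom_compNr cf cg.
Qed.
HB.instance Definition _ := GRing.isZmodClosed.Build (rhom V W) d_commuting
  d_commuting_zmod_closed.
HB.instance Definition _ := [SubChoice_isSubZmodule of Fpi_hom by <:].

End FpiHom.

Lemma Fpi_hom_comm (V W : Fpi_ob) (f : Fpi_hom V W) :
  rhom_comp f (Fpi_d V) = rhom_comp (Fpi_d W) f.
Proof. by case: f => f /= /asboolP. Qed.

Fact Fpi_id_subproof (V : Fpi_ob) : rhom_id V \in @d_commuting V V.
Proof. by apply/asboolP; apply: rhom_eq. Qed.
Definition Fpi_id V : Fpi_hom V V := FpiHom (Fpi_id_subproof V).

Lemma rhom_compA (U V W X : rep) (h : rhom W X) (g : rhom V W) (f : rhom U V) :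
  rhom_comp h (rhom_comp g f) = rhom_comp (rhom_comp h g) f.
Proof. by apply: rhom_eq. Qed.

Fact Fpi_comp_subproof (U V W : Fpi_ob) (g : Fpi_hom V W) (f : Fpi_hom U V) :
  rhom_comp g f \in @d_commuting U W.
Proof.
apply/asboolP.
by rewrite -rhom_compA Fpi_hom_comm !rhom_compA Fpi_hom_comm.
Qed.
Definition Fpi_comp U V W (g : Fpi_hom V W) (f : Fpi_hom U V) : Fpi_hom U W :=
  FpiHom (Fpi_comp_subproof g f).

Fact Fpi_compA U V W X (h : Fpi_hom W X) (g : Fpi_hom V W) (f : Fpi_hom U V) :
  Fpi_comp h (Fpi_comp g f) = Fpi_comp (Fpi_comp h g) f.
Proof. by apply: val_inj; rewrite /= rhom_compA. Qed.
Fact Fpi_comp1m V W (f : Fpi_hom V W) : Fpi_comp (Fpi_id W) f = f.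
Proof. by apply: val_inj; apply: rhom_eq. Qed.
Fact Fpi_compm1 V W (f : Fpi_hom V W) : Fpi_comp f (Fpi_id V) = f.
Proof. by apply: val_inj; apply: rhom_eq. Qed.
Fact Fpi_compDl U V W (g1 g2 : Fpi_hom V W) (f : Fpi_hom U V) :
  Fpi_comp (g1 + g2) f = Fpi_comp g1 f + Fpi_comp g2 f.
Proof. by apply: val_inj; apply: rhom_eq. Qed.
Fact Fpi_compDr U V W (g : Fpi_hom V W) (f1 f2 : Fpi_hom U V) :
  Fpi_comp g (f1 + f2) = Fpi_comp g f1 + Fpi_comp g f2.
Proof. by apply: val_inj; rewrite /= rhom_compDr. Qed.

Definition Fpi : preadditive :=
  @Preadditive Fpi_ob (fun V W => Fpi_hom V W) Fpi_id Fpi_comp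
    Fpi_compA Fpi_comp1m Fpi_compm1 Fpi_compDl Fpi_compDr.

Section E.
Variables (x y : RR) (hxy : x <= y <= x + 2 * pi).

Fact step_alpha : step (cls y) (y - x) (cls x).
Proof.
have /andP[xy _] := hxy.
by rewrite /step subr_ge0 xy -clsB opprB addrC subrK eqxx.
Qed.

Fact step_beta : step (cls x) (x + 2 * pi - y) (cls y).
Proof.
have /andP[_ yx] := hxy; have c0 := cls_turns RR 1.
rewrite mulr1 in c0.
by rewrite /step subr_ge0 yx !clsB clsD c0 addr0 opprB addrC subrK eqxx.
Qed.

(* e_x |-> e_y^(y - x) and e_y |-> e_x^(x + 2 pi - y). *)
Definition alpha_star : rhom (P (cls x)) (P (cls y)) := lift (gen step_alpha).
Definition beta_star : rhom (P (cls y)) (P (cls x)) := lift (gen step_beta).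

Fact E_d2 s v : antidiag beta_star alpha_star s
  (antidiag beta_star alpha_star s v) = t *: v.
Proof.
rewrite !antidiagE; case: v => v w.
congr (_, _); apply: star_comp; lra.
Qed.

Definition E : Fpi :=
  FpiOb (P2_finitely_generated (cls x) (cls y))
    (rsum_projective (@P_projective (cls x)) (@P_projective (cls y))) E_d2.

End E.

End Representations.
Arguments rep_map {RR R t} _ {s s' a} h.

(* Main.v *)
From HB Require Import structures.
From mathcomp Require Import all_boot all_order all_algebra ring_quotient.
From mathcomp Require Import boolp classical_sets reals trigo.
From mathcomp Require Import ring lra.
Require Import Defs.
Import Order.TTheory GRing.Theory Num.Theory.
Local Open Scope ring_scope.

(** Cut the circle at a base point.  The value of [P x] there is free of
    rank one, so a morphism [P x -> P y], with [x] and [y] in [[0, 2 pi)], is a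
    scalar of [R], its [coef]; scalars multiply under composition, and the ones
    that occur are all of [R] if [x <= y] and the multiples of [t] if [y < x]
    ([coef_surj], [coef_dvd]).

    Every endomorphism of [E x y] commuting with [d] has the form [a + b d]
    ([E_endP]).  As [(a + b d)(a - b d) = a^2 - b^2 t], it is invertible exactly
    when [a] is a unit, so the endomorphism ring is local because [R] is, and
    [E x y] is indecomposable.

    It remains to split a summand [E x y] off each nonzero object [X]
    ([E_split_mono]).  Being finitely generated projective means that the
    identity of [X] is a finite sum of composites [f_l h_l] through
    representations [P x_l].  If some [h_l f_l] is not a unit, then
    [1 - f_l h_l] is invertible and the term [l] can be removed
    ([factorization_drop]).  Otherwise consider the matrix [c] of the scalars of
    [h_l d f_m].  Since [d^2 = t], it is not zero modulo [t].  Choose [i] with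
    [x_i] maximal among the columns that contain a unit, then [j] with [x_j]
    minimal among the units of column [i].

    These choices amount to adapting a line to two filtrations of a vector
    space.  Let [A_z] be the image of [X] at [z] in [L], the value of [X] at the
    base point.  Modulo [t], the image of [d] on [L] is filtered by the
    subspaces [d A_z] and by its intersections with the [A_z].  The vector
    [d f_i] lies in the smallest nonzero [d A_z], and [x_j] is the last [z] for
    which it lies in [A_z].  Therefore [f_i] extends to a morphism
    [E x_i x_j -> X], and [h_j] to a morphism back; their composite is [a + b d]
    with [a] the unit [c_ji].  The complement is the kernel of the second map,
    on which [h_j] vanishes, so its identity is a sum of fewer terms, and
    induction on the number of terms concludes. *)

Set Implicit Arguments.
Unset Strict Implicit.
Unset Printing Implicit Defensive.

(** * Discrete valuation rings *)

Section DVR.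
Variables (R : idomainType) (t : R).
Hypotheses (hR : is_dvr R) (ht : uniformizer t).

(** Zorn's lemma for the proper ideals containing [a]. *)
Lemma nonunit_in_maximal_ideal (a : R) : a \isn't a GRing.unit ->
  exists2 J : {pred R}, maximal_ideal J & a \in J.
Proof.
move=> na.
pose ideal (A : set R) := idealr_closed (fun x : R => `[< A x >]).
(* The empty set is admitted so that empty chains have a bound. *)
pose good (A : set R) := A = set0 \/ ideal A /\ A a.
have [F FP Ftot|A [PA Amax]] := @Zorn_bigcup R good.
  have [[B [FB Ba]]|noB] := pselect (exists B, F B /\ B a); last first.
    left; apply/seteqP; split=> // x [B FB Bx].
    have [B0|[_ Ba]] := FP B FB; first by rewrite B0 in Bx.
    by case: noB; exists B.
  have idF C x : F C -> C x -> ideal C.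
    by move=> FC Cx; have [C0|[]//] := FP C FC; rewrite C0 in Cx.
  right; split; last by exists B.
  split=> [||c u v /asboolP[C FC Cu] /asboolP[D FD Dv]].
  - apply/asboolP; exists B => //.
    by have [/asboolP] := idF B a FB Ba.
  - apply/asboolP => -[C FC C1].
    by have [_ /asboolP] := idF C 1 FC C1.
  - apply/asboolP.
    have [CD|DC] := Ftot C D FC FD.
      exists D => //; have [_ _ h] := idF D v FD Dv.
      by apply/asboolP/h; apply/asboolP => //; apply: CD.
    exists C => //; have [_ _ h] := idF C u FC Cu.
    by apply/asboolP/h; apply/asboolP => //; apply: DC.
have good_a : good (fun x => exists b, x = b * a).
  right; split; last by exists 1; rewrite mul1r.
  split=> [||c u v /asboolP[b ->] /asboolP[b' ->]].
  - by apply/asboolP; exists 0; rewrite mul0r.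
  - apply/asboolP => -[b e1]; case/negP: na; apply/unitrPr.
    by exists b; rewrite mulrC -e1.
  - by apply/asboolP; exists (c * b + b'); rewrite mulrDl mulrA.
have [A0|[idA Aa]] := PA.
  case: (Amax _ _ good_a); split; first by rewrite A0.
  by rewrite A0 => /(_ a); apply; exists 1; rewrite mul1r.
exists (fun x => `[< A x >]); last exact/asboolP.
split=> // J idJ AJ x Jx; apply: contrapT => Ax.
apply: (Amax (fun x => x \in J)); first split.
- by move=> y Ay; apply: AJ; apply/asboolP.
- by move=> /(_ x Jx) /asboolP.
- right; split; last by apply: AJ; apply/asboolP.
  case: idJ => J0 J1 JD; split=> [||c u v /asboolP Ju /asboolP Jv].
  + exact/asboolP.
  + by apply/negP => /asboolP; apply/negP.
  + by apply/asboolP/JD.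
Qed.

Lemma uniformizer_nonunit : t \isn't a GRing.unit.
Proof.
case: hR => _ [M [maxM _ _]].
apply/negP => ut; case: (maxM) => -[_ /negP M1 _] _; apply: M1.
by apply/(ht maxM); exists t^-1; rewrite mulVr.
Qed.

Lemma uniformizer_neq0 : t != 0.
Proof.
case: hR => _ [M [maxM _ [x Mx x0]]].
have /(ht maxM)[b xb] := Mx.
by apply: contraNneq x0 => t0; rewrite xb t0 mulr0.
Qed.

Lemma nonunit_dvd (a : R) : a \isn't a GRing.unit -> exists b, a = b * t.
Proof.
case: hR => _ [M [maxM uniqM _]] /nonunit_in_maximal_ideal[J maxJ aJ].
by apply/(ht maxM); rewrite -(uniqM J).
Qed.

Lemma unit_subM (a b : R) : a \is a GRing.unit -> a - b * t \is a GRing.unit.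
Proof.
move=> ua; apply/contraT => /nonunit_dvd[c e].
case/negP: uniformizer_nonunit; rewrite -(subrK (b * t) a) e -mulrDl in ua.
by move: ua; rewrite unitrM => /andP[].
Qed.

Lemma nonunitD (a b : R) : a \isn't a GRing.unit -> b \isn't a GRing.unit ->
  a + b \isn't a GRing.unit.
Proof.
move=> /nonunit_dvd[c ->] /nonunit_dvd[d ->]; rewrite -mulrDl unitrM.
by rewrite (negPf uniformizer_nonunit) andbF.
Qed.

End DVR.

(** * Direct sums in preadditive categories *)

Section Preadditive.
Variable C : preadditive.
Implicit Types A B S X Y Z : C.

Lemma compm0 X Y Z (g : hom Y Z) : compm g (0 : hom X Y) = 0.
Proof. by apply: (addrI (compm g 0)); rewrite -compmDr !addr0. Qed.

Lemma comp0m X Y Z (f : hom X Y) : compm (0 : hom Y Z) f = 0.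
Proof. by apply: (addrI (compm 0 f)); rewrite -compmDl !addr0. Qed.

Lemma compm_sumr I (r : seq I) X Y Z (g : hom Y Z) (f : I -> hom X Y) :
  compm g (\sum_(i <- r) f i) = \sum_(i <- r) compm g (f i).
Proof. exact: (big_morph (compm g) (compmDr g) (compm0 X g)). Qed.

Lemma compm_suml I (r : seq I) X Y Z (g : I -> hom Y Z) (f : hom X Y) :
  compm (\sum_(i <- r) g i) f = \sum_(i <- r) compm (g i) f.
Proof.
exact: (big_morph (fun g => compm g f) (fun g h => compmDl g h f) (comp0m Z f)).
Qed.

Lemma zero_objectP Z : is_zero_object Z <-> idm Z = 0.
Proof.
split=> [zZ|e X]; first by have [+ _] := zZ Z; apply.
split=> f g; first by rewrite -(comp1m f) -(comp1m g) e !comp0m.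
by rewrite -(compm1 f) -(compm1 g) e !compm0.
Qed.

Definition biproduct A B S : Prop :=
  exists (i1 : hom A S) (p1 : hom S A) (i2 : hom B S) (p2 : hom S B),
    [/\ compm p1 i1 = idm A, compm p2 i2 = idm B, compm p2 i1 = 0,
        compm p1 i2 = 0 & compm i1 p1 + compm i2 p2 = idm S].

Lemma biproduct_is_direct_sum A B S : biproduct A B S ->
  is_direct_sum (fun b : bool => if b then A else B) S.
Proof.
move=> [i1 [p1 [i2 [p2 [e11 e22 e21 e12 e]]]]].
exists (fun b => if b return hom (if b then A else B) S then i1 else i2).
exists (fun b => if b return hom S (if b then A else B) then p1 else p2).
split=> [[]|[] []|] //; first by rewrite big_bool.
Qed.

Lemma is_direct_sum_void (X : void -> C) Z : is_zero_object Z ->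
  is_direct_sum X Z.
Proof.
move=> /zero_objectP zZ; exists (fun=> 0), (fun=> 0); split; try by case.
by rewrite zZ big1 //; case.
Qed.

Lemma is_direct_sum_cons (I : finType) (X : I -> C) A B S :
    biproduct A B S -> is_direct_sum X B ->
  is_direct_sum
    (fun i : unit + I => match i with inl _ => A | inr j => X j end) S.
Proof.
move=> [i1 [p1 [i2 [p2 [e11 e22 e21 e12 e]]]]] [inj [proj [e1 e0 eS]]].
pose Y (i : unit + I) := match i with inl _ => A | inr j => X j end.
exists (fun i => match i return hom (Y i) S with
  | inl _ => i1 | inr j => compm i2 (inj j) end).
exists (fun i => match i return hom S (Y i) with
  | inl _ => p1 | inr j => compm (proj j) p2 end).
split=> [[]|[[] []|j [[]|k]]|].
- by case.
- by move=> j; rewrite compmA -(compmA _ p2) e22 compm1.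
- by case.
- by move=> k _; rewrite -compmA e21 compm0.
- by move=> _; rewrite compmA e12 comp0m.
- move=> jk; rewrite compmA -(compmA _ p2) e22 compm1.
  by apply: e0; apply: contraNneq jk => ->.
rewrite big_sumType /= (big_pred1 tt); last by case.
rewrite -e; congr (_ + _).
under eq_bigr => j _ do rewrite compmA -(compmA i2).
by rewrite -compm_suml -compm_sumr eS compm1.
Qed.

Lemma is_direct_sum_reindex (I J : finType) (e : I -> J) (X : J -> C) S :
  bijective e -> is_direct_sum X S -> is_direct_sum (X \o e) S.
Proof.
move=> be [inj [proj [e1 e0 eS]]].
exists (fun i => inj (e i)), (fun i => proj (e i)); split=> [i|i j ij|] //.
- exact: e1.
- by apply: e0; rewrite (bij_eq be).
- by rewrite -eS [RHS](reindex e) //; exact: onW_bij.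
Qed.

(** The sum over [unit + 'I_n] built from binary sums is carried to ['I_n.+1]
    by reindexing; the families then agree only pointwise, whence [funext]. *)
Lemma binary_sums_additive Z : is_zero_object Z ->
  (forall A B, exists S, biproduct A B S) -> additive_category C.
Proof.
move=> zZ sums; elim=> [|n IHn] X.
  pose e (i : 'I_0) : void := match notF (ltn_ord i) with end.
  exists Z.
  have /= := @is_direct_sum_reindex 'I_0 void e
    (fun v : void => match v with end) Z _ (is_direct_sum_void _ zZ).
  have -> : (fun v : void => match v return C with end) \o e = X.
    by apply: funext => -[].
  by apply; exists (fun v : void => match v with end) => -[].
have [B sB] := IHn (X \o fintype.lift ord0).
have [S sS] := sums (X ord0) B; exists S.
pose e (i : 'I_n.+1) : unit + 'I_n :=
  if unlift ord0 i is Some j then inr j else inl tt.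
pose e' (i : unit + 'I_n) : 'I_n.+1 :=
  match i with inl _ => ord0 | inr j => fintype.lift ord0 j end.
have be : bijective e.
  exists e' => [i|[[]|j]]; rewrite /e /e'.
  - by case: unliftP => [j|] ->.
  - by rewrite unlift_none.
  - by rewrite liftK.
have /= := is_direct_sum_reindex be (is_direct_sum_cons sS sB).
congr (is_direct_sum _ _); apply: funext => i /=; rewrite /e.
by case: unliftP => [j|] ->.
Qed.

Lemma biproduct_zero_iso A B S : biproduct A B S -> is_zero_object B ->
  isomorphic S A.
Proof.
move=> [i1 [p1 [i2 [p2 [e11 _ _ _ e]]]]] /zero_objectP zB.
exists p1, i1; split=> //; rewrite -e -[X in _ = _ + compm i2 X]comp1m.
by rewrite zB comp0m compm0 addr0.
Qed.

(** Local endomorphism rings have no idempotents besides [0] and [1]: of the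
    two complementary projections of a direct sum one is invertible, which
    kills the other summand. *)
Lemma local_indecomposable X : local_endomorphism_ring X -> indecomposable X.
Proof.
move=> [X0 locX]; split=> [/zero_objectP//|Y [inj [proj [e1 e0]]]].
rewrite big_bool /= => eX.
have killed b : is_iso (compm (inj b) (proj b)) -> idm (Y (~~ b)) = 0.
  move=> [g [_ ge]]; rewrite -e1 -[inj _]comp1m -ge -(compmA _ g).
  rewrite !compmA (e0 b (~~ b)) ?comp0m //; last by case: (b).
have : is_iso (idm X) by exists (idm X); rewrite comp1m.
rewrite -eX => isoS.
have [/killed zf|nt] := pselect (is_iso (compm (inj true) (proj true))).
  by right; apply/zero_objectP.
have [/killed zt|nf] := pselect (is_iso (compm (inj false) (proj false))).
  by left; apply/zero_objectP.
by case: (locX _ _ nt nf isoS).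
Qed.

Lemma isomorphic_indecomposable X Y : isomorphic X Y -> indecomposable Y ->
  indecomposable X.
Proof.
move=> [f [g [gf fg]]] [nzY indY]; split=> [/zero_objectP zX|Z].
  by apply: nzY; apply/zero_objectP; rewrite -fg -[f]compm1 zX compm0 comp0m.
move=> [inj [proj [e1 e0 eX]]]; apply: indY.
exists (fun b => compm f (inj b)), (fun b => compm (proj b) g).
split=> [b|b c bc|].
- by rewrite compmA -(compmA _ g) gf compm1.
- by rewrite compmA -(compmA _ g) gf compm1 e0.
- under eq_bigr => b _ do rewrite compmA -(compmA f).
  by rewrite -compm_suml -compm_sumr eX compm1.
Qed.

End Preadditive.

(** * Morphisms and direct sums of representations *)

Local Notation "g ∘ f" := (rhom_comp g f) (at level 40, left associativity).

Section RepMorphisms.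
Variables (RR : realType) (R : comNzRingType) (t : R).
Implicit Types U V W X Y : rep RR t.

Lemma rhom_comp0l U V W (f : rhom U V) : (0 : rhom V W) ∘ f = 0.
Proof. exact: rhom_eq. Qed.

Lemma rhom_comp0r U V W (g : rhom V W) : g ∘ (0 : rhom U V) = 0.
Proof. by apply: rhom_eq => s v /=; rewrite linear0. Qed.

Lemma rhom_comp1l U V (f : rhom U V) : rhom_id V ∘ f = f.
Proof. exact: rhom_eq. Qed.

Lemma rhom_comp1r U V (f : rhom U V) : f ∘ rhom_id U = f.
Proof. exact: rhom_eq. Qed.

Lemma rhom_comp_sumr (I : finType) (A : {pred I}) U V W (g : rhom V W)
    (f : I -> rhom U V) :
  g ∘ (\sum_(i in A) f i) = \sum_(i in A) g ∘ f i.
Proof. exact: (big_morph _ (rhom_compDr g) (rhom_comp0r U g)). Qed.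

Lemma rhom_comp_suml (I : finType) (A : {pred I}) U V W (g : I -> rhom V W)
    (f : rhom U V) :
  (\sum_(i in A) g i) ∘ f = \sum_(i in A) g i ∘ f.
Proof.
exact: (big_morph (fun g => g ∘ f) (fun g h => rhom_compDl g h f)
  (rhom_comp0l W f)).
Qed.

Fact rscale_comm V (c : R) s s' a (h : step s a s') v :
  rep_map V h ((GRing.scale c : {linear V s -> V s}) v) =
  (GRing.scale c : {linear V s' -> V s'}) (rep_map V h v).
Proof. by rewrite /= linearZ. Qed.
Definition rscale V (c : R) : rhom V V := RHom (rscale_comm c).

Lemma rscaleM V b c : rscale V (b * c) = rscale V b ∘ rscale V c.
Proof. by apply: rhom_eq => s v /=; rewrite scalerA. Qed.

Lemma rscale_nat V W c (f : rhom V W) : f ∘ rscale V c = rscale W c ∘ f.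
Proof. by apply: rhom_eq => s v /=; rewrite linearZ. Qed.

Lemma rinl_rinr_id V W :
  rinl V W ∘ rfst V W + rinr V W ∘ rsnd V W = rhom_id (rsum V W).
Proof.
by apply: rhom_eq => s [v w]; congr (_, _); rewrite /= ?addr0 ?add0r.
Qed.

Lemma rfst_rinl V W : rfst V W ∘ rinl V W = rhom_id V.
Proof. exact: rhom_eq. Qed.

Lemma rsnd_rinr V W : rsnd V W ∘ rinr V W = rhom_id W.
Proof. exact: rhom_eq. Qed.

Lemma rfst_rinr V W : rfst V W ∘ rinr V W = 0.
Proof. exact: rhom_eq. Qed.

Lemma rsnd_rinl V W : rsnd V W ∘ rinl V W = 0.
Proof. exact: rhom_eq. Qed.

Definition rpair U V W (f : rhom U V) (g : rhom U W) : rhom U (rsum V W) :=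
  rinl V W ∘ f + rinr V W ∘ g.

Definition rcopair U V W (f : rhom V U) (g : rhom W U) : rhom (rsum V W) U :=
  f ∘ rfst V W + g ∘ rsnd V W.

Lemma rpairE U V W (f : rhom U V) (g : rhom U W) s u :
  rpair f g s u = (f s u, g s u) :> V s * W s.
Proof. by congr (_, _); rewrite /= ?addr0 ?add0r. Qed.

Lemma epi_comp U V W (g : rhom V W) (f : rhom U V) :
  epimorphism g -> epimorphism f -> epimorphism (g ∘ f).
Proof.
move=> eg ef s w; have [v <-] := eg s w.
by have [u <-] := ef s v; exists u.
Qed.

Lemma split_epi V W (f : rhom V W) (g : rhom W V) :
  f ∘ g = rhom_id W -> epimorphism f.
Proof.
move=> fg s w; exists (g s w).
exact: (congr1 (fun k : rhom W W => k s w) fg).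
Qed.

Lemma finitely_generated_epi V W (f : rhom V W) :
  epimorphism f -> finitely_generated V -> finitely_generated W.
Proof.
by move=> ef [xs [g eg]]; exists xs, (f ∘ g); apply: epi_comp.
Qed.

Lemma retract_projective V W (f : rhom V W) (g : rhom W V) :
  f ∘ g = rhom_id W -> projective V -> projective W.
Proof.
move=> fg pV X Y q k eq.
have [h qh] := pV _ _ q (k ∘ f) eq.
by exists (h ∘ g); rewrite rhom_compA qh -rhom_compA fg rhom_comp1r.
Qed.

Lemma rsum_epi V V' W W' (f : rhom V V') (g : rhom W W') :
  epimorphism f -> epimorphism g ->
  epimorphism (rpair (f ∘ rfst V W) (g ∘ rsnd V W)).
Proof.
move=> ef eg s [v' w'].
have [v <-] := ef s v'; have [w <-] := eg s w'.
by exists (v, w); rewrite rpairE.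
Qed.

Lemma rhom_id_epi V : epimorphism (rhom_id V).
Proof. by move=> s v; exists v. Qed.

(** Induction on the generators of [V], moving one free summand at a time across
    the sum by associativity. *)
Lemma rsum_finitely_generated V W : finitely_generated V ->
  finitely_generated W -> finitely_generated (rsum V W).
Proof.
move=> [xs [f ef]] fgW.
apply: finitely_generated_epi (rsum_epi ef (@rhom_id_epi W)) _.
elim: xs {V f ef} => [|x xs IHxs] /=.
  apply: (finitely_generated_epi (f := rinr _ W)) fgW => s [z w].
  by exists w; congr (_, _); rewrite [z]thinmx0.
set F := foldr _ _ _ in IHxs *.
have [ys [g eg]] := IHxs; exists (x :: ys).
pose assoc : rhom (rsum (P t x) (rsum F W)) (rsum (rsum (P t x) F) W) :=
  rpair (rpair (rfst _ _) (rfst _ _ ∘ rsnd _ _)) (rsnd _ _ ∘ rsnd _ _).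
have eassoc : epimorphism assoc.
  by move=> s [[u v] w]; exists (u, (v, w)); rewrite !rpairE.
exists (assoc ∘ rpair (rhom_id _ ∘ rfst _ _) (g ∘ rsnd _ _)).
by apply: epi_comp eassoc (rsum_epi (@rhom_id_epi _) eg).
Qed.

Lemma rzero_finitely_generated : finitely_generated (rzero RR t).
Proof. by exists [::], (rhom_id _); apply: rhom_id_epi. Qed.

Lemma rzero_projective : projective (rzero RR t).
Proof.
move=> V W g f _; exists 0; apply: rhom_eq => s v.
by rewrite [v]thinmx0 !linear0.
Qed.

Lemma Fpi_hom_eq (V W : Fpi_ob RR t) (f g : Fpi_hom V W) :
  (f : rhom V W) = g -> f = g.
Proof. exact: val_inj. Qed.

Lemma Fpi_dd (V : Fpi_ob RR t) : Fpi_d V ∘ Fpi_d V = rscale V t.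
Proof. by apply: rhom_eq => s v; rewrite /= Fpi_d2. Qed.

Fact Fpi_zero_d2 s (v : rzero RR t s) :
  (0 : rhom (rzero RR t) (rzero RR t)) s
    ((0 : rhom (rzero RR t) (rzero RR t)) s v) = t *: v.
Proof. by rewrite [LHS]thinmx0 [RHS]thinmx0. Qed.

Definition Fpi_zero : Fpi RR t :=
  FpiOb rzero_finitely_generated rzero_projective Fpi_zero_d2.

Lemma Fpi_zeroP : is_zero_object Fpi_zero.
Proof.
apply/zero_objectP/Fpi_hom_eq/rhom_eq => s v.
by rewrite [LHS]thinmx0 [RHS]thinmx0.
Qed.

Section FpiSum.
Variables V W : Fpi RR t.

Definition Fpi_sum_d : rhom (rsum V W) (rsum V W) :=
  rpair (Fpi_d V ∘ rfst V W) (Fpi_d W ∘ rsnd V W).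

Fact Fpi_sum_d2 s v : Fpi_sum_d s (Fpi_sum_d s v) = t *: v.
Proof. by rewrite !rpairE /= !Fpi_d2. Qed.

Definition Fpi_sum : Fpi RR t :=
  FpiOb (rsum_finitely_generated (Fpi_fg V) (Fpi_fg W))
    (rsum_projective (@Fpi_projective _ _ _ V) (@Fpi_projective _ _ _ W))
    Fpi_sum_d2.

Lemma Fpi_sum_biproduct : biproduct V W Fpi_sum.
Proof.
have i1P : rinl V W \in @d_commuting _ _ _ V Fpi_sum.
  apply/asboolP; apply: rhom_eq => s v.
  by congr (_, _); rewrite /= ?linear0 ?addr0 ?add0r.
have p1P : rfst V W \in @d_commuting _ _ _ Fpi_sum V.
  by apply/asboolP; apply: rhom_eq => s v; rewrite /= addr0.
have i2P : rinr V W \in @d_commuting _ _ _ W Fpi_sum.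
  apply/asboolP; apply: rhom_eq => s v.
  by congr (_, _); rewrite /= ?linear0 ?addr0 ?add0r.
have p2P : rsnd V W \in @d_commuting _ _ _ Fpi_sum W.
  by apply/asboolP; apply: rhom_eq => s v; rewrite /= add0r.
exists (FpiHom i1P), (FpiHom p1P), (FpiHom i2P), (FpiHom p2P).
split; apply: Fpi_hom_eq.
- exact: rfst_rinl.
- exact: rsnd_rinr.
- exact: rsnd_rinl.
- exact: rfst_rinr.
- exact: rinl_rinr_id.
Qed.

End FpiSum.

Lemma Fpi_additive : additive_category (Fpi RR t).
Proof.
apply: binary_sums_additive Fpi_zeroP _ => V W.
by exists (Fpi_sum V W); apply: Fpi_sum_biproduct.
Qed.

End RepMorphisms.

(** * Kernels and complements *)

Section Kernel.
Variables (RR : realType) (R : comNzRingType) (t : R).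
Variables (X Y : rep RR t) (g : rhom X Y).

Definition ker_pred s : {pred X s} := fun v => g s v == 0.

Fact ker_submod_closed s : submod_closed (@ker_pred s).
Proof.
split=> [|c u v]; first by rewrite unfold_in linear0.
by rewrite !unfold_in linearP => /eqP-> /eqP->; rewrite scaler0 addr0.
Qed.
HB.instance Definition _ s := GRing.isSubmodClosed.Build R (X s) (@ker_pred s)
  (@ker_submod_closed s).

Record ker s := Ker { ker_val : X s; ker_valP : ker_val \in @ker_pred s }.
HB.instance Definition _ s := [isSub for @ker_val s].
HB.instance Definition _ s := [Choice of ker s by <:].
HB.instance Definition _ s := [SubChoice_isSubLmodule of ker s by <:].

Section Map.
Variables (s s' : S1 RR) (a : RR) (h : step s a s').

Fact ker_map_subproof (v : ker s) : rep_map X h (ker_val v) \in @ker_pred s'.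
Proof.
by have /eqP gv := ker_valP v; rewrite unfold_in -rhom_comm gv linear0.
Qed.
Definition ker_map_fun (v : ker s) : ker s' := Ker (ker_map_subproof v).
Fact ker_map_linear : linear ker_map_fun.
Proof. by move=> c u v; apply: val_inj; rewrite /= linearP. Qed.
HB.instance Definition _ := GRing.isLinear.Build R (ker s) (ker s') _
  ker_map_fun ker_map_linear.
Definition ker_map : {linear ker s -> ker s'} := ker_map_fun.
End Map.

Fact ker_mapD s s' s'' a b (h : step s b s') (h' : step s' a s'')
    (h'' : step s (a + b) s'') v :
  ker_map h' (ker_map h v) = ker_map h'' v.
Proof. by apply: val_inj; rewrite /= (rep_mapD _ _ h''). Qed.
Fact ker_map_turns s n (h : step s (2 * pi * n%:R) s) v :
  ker_map h v = t ^+ n *: v.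
Proof. by apply: val_inj; rewrite /= rep_map_turns. Qed.
Definition kernel : rep RR t :=
  @Rep _ _ t (fun s => ker s : lmodType R) ker_map ker_mapD ker_map_turns.

Fact kernel_incl_linear s : linear (@ker_val s).
Proof. by []. Qed.
HB.instance Definition _ s := GRing.isLinear.Build R (ker s) (X s) _
  (@ker_val s) (@kernel_incl_linear s).
Fact kernel_incl_comm s s' a (h : step s a s') (v : kernel s) :
  rep_map X h ((@ker_val s : {linear ker s -> X s}) v) =
  (@ker_val s' : {linear ker s' -> X s'}) (rep_map kernel h v).
Proof. by []. Qed.
Definition kernel_incl : rhom kernel X := RHom kernel_incl_comm.

Lemma kernel_inclP : g ∘ kernel_incl = 0.
Proof. by apply: rhom_eq => s v; have /eqP := ker_valP v. Qed.

Section KernelLift.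
Variables (W : rep RR t) (q : rhom W X).
Hypothesis gq : g ∘ q = 0.

Fact kernel_lift_subproof s (w : W s) : q s w \in @ker_pred s.
Proof. by apply/eqP; apply: (congr1 (fun k : rhom W Y => k s w) gq). Qed.
Definition kernel_lift_fun s (w : W s) : ker s := Ker (kernel_lift_subproof w).
Fact kernel_lift_linear s : linear (@kernel_lift_fun s).
Proof. by move=> c u v; apply: val_inj; rewrite /= linearP. Qed.
HB.instance Definition _ s := GRing.isLinear.Build R (W s) (ker s) _
  (@kernel_lift_fun s) (@kernel_lift_linear s).
Fact kernel_lift_comm s s' a (h : step s a s') (w : W s) :
  rep_map kernel h ((@kernel_lift_fun s : {linear W s -> ker s}) w) =
  (@kernel_lift_fun s' : {linear W s' -> ker s'}) (rep_map W h w).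
Proof. by apply: val_inj; rewrite /= rhom_comm. Qed.
Definition kernel_lift : rhom W kernel := RHom kernel_lift_comm.

Lemma kernel_liftP : kernel_incl ∘ kernel_lift = q.
Proof. exact: rhom_eq. Qed.
End KernelLift.

Lemma kernel_incl_inj (W : rep RR t) (q q' : rhom W kernel) :
  kernel_incl ∘ q = kernel_incl ∘ q' -> q = q'.
Proof.
move=> e; apply: rhom_eq => s w; apply: val_inj.
exact: (congr1 (fun k : rhom W X => k s w) e).
Qed.

End Kernel.

Section Complement.
Variables (RR : realType) (R : comNzRingType) (t : R).

(** The complement is the kernel of the retraction: it inherits [d], and it is
    finitely generated projective as a retract. *)
Lemma Fpi_complement (E X : Fpi RR t) (f : hom E X) (g : hom X E) :
    compm g f = idm E ->
  exists (Y : Fpi RR t) (i : hom Y X) (q : hom X Y),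
    [/\ compm q i = idm Y, compm g i = 0, compm q f = 0
      & compm f g + compm i q = idm X].
Proof.
move=> gf; pose f' : rhom E X := Fpi_fun f; pose g' : rhom X E := Fpi_fun g.
have {}gf : g' ∘ f' = rhom_id E := congr1 (@Fpi_fun _ _ _ _ _) gf.
pose i := kernel_incl g'.
have gi : g' ∘ i = 0 by exact: kernel_inclP.
have gq : g' ∘ (rhom_id X - f' ∘ g') = 0.
  rewrite rhom_compDr rhom_compNr rhom_compA gf rhom_comp1r rhom_comp1l.
  exact: subrr.
pose q := kernel_lift gq.
have iq : i ∘ q = rhom_id X - f' ∘ g' := kernel_liftP gq.
have qi : q ∘ i = rhom_id _.
  apply: (@kernel_incl_inj _ _ _ _ _ g'); rewrite rhom_compA iq rhom_comp1r.
  rewrite rhom_compDl rhom_compNl -rhom_compA gi rhom_comp0r subr0.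
  exact: rhom_comp1l.
have fd : f' ∘ Fpi_d E = Fpi_d X ∘ f' := Fpi_hom_comm f.
have gd : g' ∘ Fpi_d X = Fpi_d E ∘ g' := Fpi_hom_comm g.
pose d := q ∘ Fpi_d X ∘ i.
have id : i ∘ d = Fpi_d X ∘ i.
  rewrite /d !rhom_compA iq rhom_compDl rhom_compNl rhom_comp1l rhom_compDl.
  by rewrite rhom_compNl -!rhom_compA [g' ∘ _]rhom_compA gd -rhom_compA gi
    !rhom_comp0r subr0.
have d2 s (v : kernel g' s) : d s (d s v) = t *: v.
  suff e : d ∘ d = rscale _ t.
    exact: (congr1 (fun k : rhom (kernel g') (kernel g') => k s v) e).
  apply: (@kernel_incl_inj _ _ _ _ _ g').
  rewrite rhom_compA id -rhom_compA id rhom_compA Fpi_dd.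
  by rewrite rscale_nat.
pose Y : Fpi RR t := FpiOb
  (finitely_generated_epi (split_epi qi) (Fpi_fg X))
  (retract_projective qi (@Fpi_projective _ _ _ X)) d2.
have iP : i \in @d_commuting _ _ _ Y X by apply/asboolP.
have qP : q \in @d_commuting _ _ _ X Y.
  apply/asboolP; apply: (@kernel_incl_inj _ _ _ _ _ g').
  rewrite /= rhom_compA iq rhom_compA id -[in RHS]rhom_compA iq.
  by rewrite !(rhom_compDl, rhom_compDr, rhom_compNl, rhom_compNr)
    -rhom_compA gd !rhom_compA fd rhom_comp1l rhom_comp1r.
exists Y, (FpiHom iP), (FpiHom qP); split; apply: Fpi_hom_eq.
- exact: qi.
- exact: gi.
- apply: (@kernel_incl_inj _ _ _ _ _ g'); rewrite /= rhom_compA iq.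
  rewrite rhom_compDl rhom_compNl -rhom_compA gf rhom_comp1r rhom_comp1l subrr.
  by rewrite rhom_comp0r.
- by rewrite /= iq addrC subrK.
Qed.

End Complement.

(** * Evaluation at a base point *)

Section BasePoint.
Variables (RR : realType) (R : idomainType) (t : R).
Hypothesis t0 : t != 0.
Implicit Types (V W : rep RR t) (x y z : RR).

Local Notation base := (cls (0 : RR)).
Local Notation Px x := (P t (cls x)).

Definition in_circle x := 0 <= x < 2 * pi.

Lemma turns_add_period x : 0 <= x -> turns (x + 2 * pi) = (turns x).+1.
Proof. by move=> x0; have := turnsD 1 x0; rewrite mulr1 addn1. Qed.

Definition torsion_free V := forall s (v : V s), t *: v = 0 -> v = 0.

(** Rotating on from the base point back to [s] makes up full turns, and these
    act as a power of [t]. *)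
Lemma torsion_free_base V s (v : V s) : torsion_free V ->
  rep_map V (step_angle s base) v = 0 -> v = 0.
Proof.
move=> tfV e.
have h := step_trans (step_angle s base) (step_angle base s).
have h' : step s (angle base s + angle s base) s by rewrite addrC.
have e2 := step_angleE h'; rewrite angle_refl add0r in e2.
have := rep_mapD (step_angle s base) (step_angle base s) h' v.
rewrite e linear0; set n := turns _ in e2.
have h'' : step s (2 * pi * n%:R) s by exact: step_turns.
rewrite (rep_map_eq h' h'') // rep_map_turns.
elim: n {e2 h''} => [|n IHn]; first by rewrite scale1r.
by rewrite exprS -scalerA => /esym/tfV/esym.
Qed.

Lemma rhom_base_inj V W (f g : rhom V W) : torsion_free W ->
  f base =1 g base -> f = g.
Proof.
move=> tfW fg; apply: rhom_eq => s v; apply/eqP; rewrite -subr_eq0; apply/eqP.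
by apply: (torsion_free_base tfW); rewrite linearB /= !rhom_comm fg subrr.
Qed.

Lemma torsion_free_rhom V W (f g : rhom V W) : torsion_free W ->
  rscale W t ∘ f = rscale W t ∘ g -> f = g.
Proof.
move=> tfW e; apply: rhom_eq => s v; apply/eqP; rewrite -subr_eq0; apply/eqP.
apply: tfW; rewrite scalerBr; apply/eqP; rewrite subr_eq0; apply/eqP.
exact: (congr1 (fun k : rhom V W => k s v) e).
Qed.

Lemma P_torsion_free s : torsion_free (P t s).
Proof.
by move=> s' v /eqP; rewrite [_ == _]mulf_eq0 (negPf t0) => /eqP.
Qed.

Lemma rsum_torsion_free V W : torsion_free V -> torsion_free W ->
  torsion_free (rsum V W).
Proof.
by move=> tfV tfW s [v w] [/tfV-> /tfW->].
Qed.

Lemma angle_base x : in_circle x -> angle (cls x) base = x.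
Proof.
move=> /andP[x0 x2]; apply/esym/angle_uniq => //.
by rewrite /step x0 -clsB subrr eqxx.
Qed.

Lemma cls_surj (s : S1 RR) : exists2 x, in_circle x & cls x = s.
Proof.
exists (angle s base); first exact: angle_itv.
by rewrite cls_angle -[s]cls_repr -clsB subr0.
Qed.

(** The value of [Px x] at the base point is free on one generator, so every
    morphism between such representations acts there as a scalar. *)
Definition coef (s s' : S1 RR) (f : rhom (P t s) (P t s')) : R :=
  f base (1 : R^o).

Lemma coefE s s' (f : rhom (P t s) (P t s')) (r : R^o) :
  f base r = r * coef f.
Proof.
transitivity (f base (r *: (1 : R^o))); first by rewrite [_ *: _]mulr1.
by rewrite linearZ.
Qed.

Lemma coef_comp s s' s'' (g : rhom (P t s') (P t s''))
    (f : rhom (P t s) (P t s')) :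
  coef (g ∘ f) = coef g * coef f.
Proof. by rewrite {1}/coef /= coefE mulrC. Qed.

Lemma coef_inj s s' (f g : rhom (P t s) (P t s')) : coef f = coef g -> f = g.
Proof.
move=> e; apply: rhom_base_inj; first exact: P_torsion_free.
by move=> r; rewrite !coefE e.
Qed.

Lemma coefD s s' (f g : rhom (P t s) (P t s')) : coef (f + g) = coef f + coef g.
Proof. by []. Qed.

Lemma coef0 s s' : coef (0 : rhom (P t s) (P t s')) = 0.
Proof. by []. Qed.

Lemma coef_sum (I : finType) (A : {pred I}) s s'
    (f : I -> rhom (P t s) (P t s')) :
  coef (\sum_(i in A) f i) = \sum_(i in A) coef (f i).
Proof. exact: (big_morph _ (@coefD s s') (coef0 s s')). Qed.

Lemma coef_scale s c : coef (rscale (P t s) c) = c.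
Proof. exact: mulr1. Qed.

Lemma coef_lift_gen x y a (h : step (cls y) a (cls x)) : in_circle x ->
  coef (lift (gen t h)) = t ^+ turns (a + x).
Proof.
move=> hx; rewrite /coef /= /lift_fun scale1r.
have h2 := step_trans h (step_angle (cls x) base).
by rewrite (P_map_gen t h _ h2) /gen angle_base.
Qed.

Lemma coef_alpha x y (hxy : x <= y <= x + 2 * pi) :
  in_circle x -> in_circle y -> coef (alpha_star t hxy) = 1.
Proof. by move=> hx hy; rewrite coef_lift_gen // subrK turns_lt. Qed.

Lemma coef_beta x y (hxy : x <= y <= x + 2 * pi) :
  in_circle x -> in_circle y -> coef (beta_star t hxy) = t.
Proof.
move=> hx hy; rewrite coef_lift_gen // subrK turns_add_period; last first.
  by case/andP: hx.
by rewrite turns_lt // expr1.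
Qed.

(** Rotating from [y] to [x > y] and on to the base point takes the angle
    [y + 2 pi], which contains a full turn, that is a factor [t]. *)
Lemma coef_dvd x y (f : rhom (Px x) (Px y)) : in_circle x -> in_circle y ->
  y < x -> exists b, coef f = b * t.
Proof.
move=> hx hy yx; exists (f (cls x) (gen t (step0 _))).
rewrite /coef P_homE scale1r /=.
have -> : angle (cls y) (cls x) = y + 2 * pi - x.
  apply/esym/angle_uniq; last by lra.
  rewrite /step clsB clsD; have := cls_turns RR 1; rewrite mulr1 => ->.
  rewrite addr0 opprB [cls y + _]addrC subrK eqxx andbT.
  by case/andP: hx hy => ? ? /andP[? ?]; lra.
rewrite angle_base // subrK turns_add_period; last by case/andP: hy.
by rewrite turns_lt // expr1 [RHS]mulrC.
Qed.

Lemma coef_surj x y c : in_circle x -> in_circle y ->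
  (y < x -> exists b, c = b * t) -> exists f : rhom (Px x) (Px y), coef f = c.
Proof.
move=> hx hy hc; have [/andP[x0 x2] /andP[y0 y2]] := (hx, hy).
have [xy|yx] := leP x y.
  have hxy : x <= y <= x + 2 * pi by lra.
  exists (rscale _ c ∘ alpha_star t hxy).
  by rewrite coef_comp coef_scale coef_alpha ?mulr1.
have [b ->] := hc yx.
have hyx : y <= x <= y + 2 * pi by lra.
exists (rscale _ b ∘ beta_star t hyx).
by rewrite coef_comp coef_scale coef_beta.
Qed.

End BasePoint.

(** * Endomorphisms of [E x y] *)

Section EndE.
Variables (RR : realType) (R : idomainType) (t : R).
Hypotheses (hR : is_dvr R) (ht : uniformizer t).
Local Notation base := (cls (0 : RR)).

Let t0 : t != 0 := uniformizer_neq0 hR ht.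

Definition Fpi_affine (V : Fpi RR t) (a b : R) : rhom V V :=
  rscale V a + rscale V b ∘ Fpi_d V.

Lemma Fpi_affine_comm (V : Fpi RR t) a b :
  Fpi_affine V a b \in @d_commuting _ _ _ V V.
Proof.
by apply/asboolP; apply: rhom_eq => s v; rewrite /= linearD !linearZ.
Qed.

Lemma Fpi_affine_comp (V : Fpi RR t) a b c e :
  Fpi_affine V a b ∘ Fpi_affine V c e =
  Fpi_affine V (a * c + b * e * t) (a * e + b * c).
Proof.
apply: rhom_eq => s v; rewrite /= !(linearD, linearZ) /= Fpi_d2.
rewrite !scalerA !scalerDl [c * a]mulrC [e * a]mulrC [c * b]mulrC.
by rewrite [e * b]mulrC [X in _ + X]addrC addrACA.
Qed.

Lemma Fpi_affine_id (V : Fpi RR t) : Fpi_affine V 1 0 = rhom_id V.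
Proof. by apply: rhom_eq => s v; rewrite /= scale1r scale0r addr0. Qed.

(** The inverse of [a + b d] is [(a - b d) / (a^2 - b^2 t)]. *)
Lemma Fpi_affine_iso (V : Fpi RR t) (f : hom V V) a b :
  (f : Fpi_hom V V) = Fpi_affine V a b :> rhom V V -> a \is a GRing.unit ->
  is_iso f.
Proof.
move=> fE ua.
have uu : a * a - b * b * t \is a GRing.unit.
  by apply: unit_subM; rewrite ?unitrM ?ua.
set u := _ - _ in uu.
exists (FpiHom (Fpi_affine_comm V (u^-1 * a) (- (u^-1 * b)))).
split; apply: Fpi_hom_eq; rewrite /= fE Fpi_affine_comp -Fpi_affine_id;
  congr Fpi_affine; rewrite -?(mulVr uu) /u; ring.
Qed.

Variables (x y : RR) (hxy : x <= y <= x + 2 * pi).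
Hypotheses (hx : in_circle x) (hy : in_circle y).

Lemma E_d_base (v : R * R) :
  Fpi_d (E t hxy) base v = (t * v.2, v.1) :> R * R.
Proof.
rewrite antidiagE !coefE coef_alpha // coef_beta // mulr1.
by rewrite [t * _]mulrC.
Qed.

Lemma Fpi_affine_base a b (v : R * R) :
  Fpi_affine (E t hxy) a b base v =
  (a * v.1 + b * (t * v.2), a * v.2 + b * v.1) :> R * R.
Proof.
have -> : Fpi_affine (E t hxy) a b base v =
  a *: (v : E t hxy base) + b *: Fpi_d (E t hxy) base v by [].
by rewrite E_d_base.
Qed.

(** Commuting with [d], an endomorphism is determined by the image of the
    generator of [P x], as at the base point the generator of [P y] is its
    image under [d]. *)
Lemma E_endP (f : Fpi_hom (E t hxy) (E t hxy)) :
  f = Fpi_affine (E t hxy) (f base ((0, 1) : R * R)).2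
                           (f base ((1, 0) : R * R)).2 :> rhom _ _.
Proof.
apply: rhom_base_inj => //.
  by apply: rsum_torsion_free; apply: P_torsion_free.
move=> [u v].
have fd (w : R * R) : f base (Fpi_d (E t hxy) base w) =
    Fpi_d (E t hxy) base (f base w).
  exact: (congr1 (fun k : rhom (E t hxy) (E t hxy) => k base w)
    (Fpi_hom_comm f)).
have e01 : ((0, 1) : R * R) = Fpi_d (E t hxy) base ((1, 0) : R * R).
  by rewrite E_d_base /= mulr0.
have f01 := fd ((1, 0) : R * R); rewrite -e01 E_d_base in f01.
have -> : f base ((u, v) : R * R) =
    u *: f base ((1, 0) : R * R) + v *: f base ((0, 1) : R * R).
  rewrite -!linearZ -linearD; congr (f base _).
  by congr (_, _); rewrite /= /GRing.scale /=; ring.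
rewrite Fpi_affine_base f01; case: (f base _) => p q.
by congr (_, _); rewrite /= /GRing.scale /=; ring.
Qed.

Lemma E_iso_unit (f : hom (E t hxy) (E t hxy)) :
  is_iso f <-> ((f : Fpi_hom _ _) base ((0, 1) : R * R)).2 \is a GRing.unit.
Proof.
split=> [[g [_ fg]]|]; last by apply: Fpi_affine_iso; apply: E_endP.
have := congr1 (fun k : Fpi_hom (E t hxy) (E t hxy) =>
  (k base ((0, 1) : R * R)).2) fg.
rewrite /= (E_endP f) (E_endP g) !Fpi_affine_base /=.
rewrite !mulr0 !add0r !addr0 !mulr1.
set a := (Fpi_fun f base _).2; set b := (Fpi_fun f base _).2.
set a' := (Fpi_fun g base _).2; set b' := (Fpi_fun g base _).2 => e.
apply/contraT => /(nonunit_dvd hR ht)[r ar].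
case/negP: (uniformizer_nonunit hR ht); apply/unitrPr.
by exists (r * a' + b * b'); rewrite -e ar; ring.
Qed.

Lemma E_local : local_endomorphism_ring (E t hxy : Fpi RR t).
Proof.
split=> [/(congr1 (fun k : Fpi_hom (E t hxy) (E t hxy) =>
    (k base ((0, 1) : R * R)).2)) /= /eqP|f g].
  by rewrite oner_eq0.
rewrite !E_iso_unit => /negP nf /negP ng; apply/negP.
exact: (nonunitD hR ht nf ng).
Qed.

End EndE.

(** * Splitting off a summand [E x y] *)

Section Factors.
Variables (RR : realType) (R : idomainType) (t : R).

(** Bundling the position with the two maps makes families of factors
    non-dependent functions, which can be reindexed and transported freely. *)
Record factor (V : rep RR t) := Factor {
  fpos : RR;
  fpos_in_circle : in_circle fpos;
  fin : rhom (P t (cls fpos)) V;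
  fout : rhom V (P t (cls fpos))
}.

Definition factorization V (I : finType) (A : {set I}) (p : I -> factor V) :=
  \sum_(l in A) fin (p l) ∘ fout (p l) = rhom_id V.

Definition factor_map V W (f : rhom V W) (g : rhom W V) (p : factor V) :=
  Factor (fpos_in_circle p) (f ∘ fin p) (fout p ∘ g).

Lemma factorization_retract V W (f : rhom V W) (g : rhom W V) (I : finType)
    (A : {set I}) (p : I -> factor V) :
  f ∘ g = rhom_id W -> factorization A p ->
  factorization A (fun l => factor_map f g (p l)).
Proof.
rewrite /factorization => fg e /=.
under eq_bigr => l _ do rewrite rhom_compA -(rhom_compA f).
by rewrite -rhom_comp_suml -rhom_comp_sumr e rhom_comp1r.
Qed.

Lemma factor_sum (I : finType) (A : {set I}) V (p : I -> factor V) U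
    (g : rhom U V) : factorization A p ->
  g = \sum_(l in A) fin (p l) ∘ (fout (p l) ∘ g).
Proof.
move=> e; rewrite -[LHS]rhom_comp1l -e rhom_comp_suml.
by apply: eq_bigr => l _; rewrite rhom_compA.
Qed.

Lemma factor_sumr (I : finType) (A : {set I}) V (p : I -> factor V) U
    (g : rhom V U) : factorization A p ->
  g = \sum_(l in A) g ∘ fin (p l) ∘ fout (p l).
Proof.
move=> e; rewrite -[LHS]rhom_comp1r -e rhom_comp_sumr.
by apply: eq_bigr => l _; rewrite rhom_compA.
Qed.

Lemma free_factorization (xs : seq (S1 RR)) :
  exists (I : finType)
    (p : I -> factor (foldr (fun x => rsum (P t x)) (rzero RR t) xs)),
    factorization [set: I] p.
Proof.
elim: xs => [|s xs [I [p e]]] /=.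
  pose p := fun v : void => match v return factor (rzero RR t) with end.
  exists void, p; rewrite /factorization big1 => [|[]//].
  by apply: rhom_eq => s v; rewrite [LHS]thinmx0 [RHS]thinmx0.
set F := foldr _ _ _ in p e *.
have [x hx <-] := cls_surj s.
pose q (i : unit + I) : factor (rsum (P t (cls x)) F) :=
  match i with
  | inl _ => Factor hx (rinl _ _) (rfst _ _)
  | inr l => factor_map (rinr _ _) (rsnd _ _) (p l)
  end.
exists (unit + I)%type, q; rewrite /factorization.
rewrite (eq_bigl predT) => [|i]; last by rewrite inE.
rewrite big_sumType /= (big_pred1 tt); last by case.
rewrite -rinl_rinr_id; congr (_ + _).
transitivity (\sum_(l in [set: I])
    rinr (P t (cls x)) F ∘ (fin (p l) ∘ fout (p l)) ∘ rsnd (P t (cls x)) F).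
  by apply: eq_big => l; rewrite ?inE // => _; rewrite !rhom_compA.
by rewrite -rhom_comp_suml -rhom_comp_sumr e rhom_comp1r.
Qed.

Lemma fg_projective_factorization V : finitely_generated V -> projective V ->
  exists (I : finType) (p : I -> factor V), factorization [set: I] p.
Proof.
move=> [xs [f ef]] pV; have [g fg] := pV _ _ f (rhom_id V) ef.
have [I [p e]] := free_factorization xs.
by exists I, (fun l => factor_map f g (p l)); apply: factorization_retract.
Qed.

Lemma rhom_sumE (I : finType) (A : {pred I}) (V W : rep RR t)
    (f : I -> rhom V W) s v :
  (\sum_(l in A) f l) s v = \sum_(l in A) f l s v.
Proof. exact: (big_morph (fun f : rhom V W => f s v)). Qed.

(** The maps [h_l] jointly embed [V] into torsion-free representations. *)
Lemma factorization_torsion_free (I : finType) (A : {set I}) V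
    (p : I -> factor V) : t != 0 -> factorization A p -> torsion_free V.
Proof.
move=> t0 e s v tv.
have -> : v = rhom_id V s v by [].
rewrite -e rhom_sumE big1 // => l _ /=.
by rewrite [fout _ s v](P_torsion_free t0) ?linear0 // -linearZ tv linear0.
Qed.

(** The other terms sum to [1 - f h], where [f] and [h] are the maps of the
    factor [l]; this is invertible, with inverse [1 + f (1 - h f)^-1 h]. *)
Lemma factorization_drop (I : finType) (A : {set I}) V (p : I -> factor V) l :
    is_dvr R -> uniformizer t -> factorization A p -> l \in A ->
    coef (fout (p l) ∘ fin (p l)) \isn't a GRing.unit ->
  exists q : I -> factor V, factorization (A :\ l) q.
Proof.
move=> hR ht e lA /(nonunit_dvd hR ht)[b cb].
pose f := fin (p l); pose h := fout (p l).
have u1 : 1 - coef (h ∘ f) \is a GRing.unit.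
  by rewrite cb unit_subM ?unitr1.
pose u := (1 - coef (h ∘ f))^-1.
have hf : h ∘ f = rscale _ (coef (h ∘ f)).
  by apply: (coef_inj (uniformizer_neq0 hR ht)); rewrite coef_scale.
pose g := rhom_id V + f ∘ rscale _ u ∘ h.
exists (fun m => factor_map g (rhom_id V) (p m)); rewrite /factorization /=.
have e' : \sum_(m in A :\ l) fin (p m) ∘ fout (p m) = rhom_id V - f ∘ h.
  by rewrite -e [in RHS](big_setD1 l) //= [RHS]addrC addKr.
under eq_bigr => m _ do rewrite rhom_comp1r -rhom_compA.
rewrite -rhom_comp_sumr e' rhom_compDr rhom_compNr rhom_comp1r.
rewrite rhom_compDl rhom_comp1l -!rhom_compA [h ∘ (f ∘ h)]rhom_compA hf.
rewrite [rscale _ u ∘ (_ ∘ h)]rhom_compA -rscaleM.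
apply: rhom_eq => s v /=; rewrite !linearZ /=.
set w := f s (h s v); have : u - 1 - u * coef (h ∘ f) = 0.
  by rewrite addrAC -{1}[u]mulr1 -mulrBr mulVr // subrr.
move=> /(congr1 (fun c => c *: w)); rewrite scale0r !scalerBl scale1r => e0.
by rewrite -addrA opprD [u *: w + _]addrA e0 addr0.
Qed.

End Factors.

Section Splitting.
Variables (RR : realType) (R : idomainType) (t : R).
Hypotheses (hR : is_dvr R) (ht : uniformizer t).
Local Notation base := (cls (0 : RR)).

Let t0 : t != 0 := uniformizer_neq0 hR ht.

Variables (X : Fpi RR t) (I : finType) (A : {set I}) (p : I -> factor X).
Hypothesis pA : factorization A p.

Local Notation x l := (fpos (p l)).
Local Notation f l := (fin (p l)).
Local Notation h l := (fout (p l)).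
Local Notation d := (Fpi_d X).

(** The matrix of [d] in the generating family given by the factors. *)
Definition dcoef l m : R := coef (h l ∘ d ∘ f m).

Let torsion_freeX : torsion_free X := factorization_torsion_free t0 pA.

Lemma dcoef_square l k :
  \sum_(m in A) dcoef l m * dcoef m k = t * coef (h l ∘ f k).
Proof.
have -> : t * coef (h l ∘ f k) = coef (h l ∘ d ∘ d ∘ f k).
  rewrite -(rhom_compA (h l)) Fpi_dd rscale_nat -rhom_compA coef_comp.
  by rewrite coef_scale.
rewrite -[h l ∘ d](rhom_comp1r) -pA rhom_comp_sumr !rhom_comp_suml coef_sum.
by apply: eq_bigr => m _; rewrite -coef_comp !rhom_compA.
Qed.

(** If the matrix of [d] vanished modulo [t], its square would vanish modulo
    [t^2], whereas the square of [d] is [t]. *)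
Lemma dcoef_unit l : l \in A -> coef (h l ∘ f l) \is a GRing.unit ->
  exists i j, [/\ i \in A, j \in A & dcoef j i \is a GRing.unit].
Proof.
move=> lA ul; apply: contrapT => nou.
have {}nou m : m \in A -> exists b, dcoef l m * dcoef m l = t * (b * t).
  move=> mA.
  have nonunit i j : i \in A -> j \in A -> exists b, dcoef j i = b * t.
    move=> iA jA; apply: (nonunit_dvd hR ht); apply/negP => u.
    by apply: nou; exists i, j.
  have [[b ->] [c ->]] := (nonunit m l mA lA, nonunit l m lA mA).
  by exists (b * c); ring.
have [b bE] : exists b : I -> R,
    forall m, m \in A -> dcoef l m * dcoef m l = t * (b m * t).
  have ex m : exists b : R, m \in A -> dcoef l m * dcoef m l = t * (b * t).
    have [mA|nm] := boolP (m \in A); last by exists 0.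
    by have [b] := nou m mA; exists b.
  by exists (fun m => sval (cid (ex m))) => m; case: cid.
have := dcoef_square l l; rewrite (eq_bigr _ bE) -mulr_sumr -mulr_suml.
move=> /(mulfI t0) e; rewrite -e unitrM in ul.
by case/andP: ul => _; rewrite (negPf (uniformizer_nonunit hR ht)).
Qed.

(** The choice of [i] and [j], extremal among the unit entries of the matrix of
    [d], is the one that gives morphisms [E -> X -> E] extending [f i] and
    [h j].  The last conclusion says that the factor [j] vanishes on the
    complement, which makes the induction on the number of factors work. *)
Lemma E_split_mono : (exists2 l, l \in A & coef (h l ∘ f l) \is a GRing.unit) ->
  exists (x y : RR) (hxy : x <= y <= x + 2 * pi)
         (a : hom (E t hxy) X) (b : hom X (E t hxy)) (j : I),
    [/\ in_circle x, in_circle y, j \in A, compm b a = idm _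
      & forall (Y : Fpi RR t) (k : hom Y X), compm b k = 0 ->
          h j ∘ (k : Fpi_hom Y X) = 0].
Proof.
move=> [l lA ul].
have [i0 [j0 [i0A j0A u0]]] := dcoef_unit lA ul.
pose good m := (m \in A) && [exists k in A, dcoef k m \is a GRing.unit].
have good0 : good i0.
  by rewrite /good i0A; apply/existsP; exists j0; rewrite j0A.
case: (arg_maxP (fun m => x m) good0) => i /andP[iA /existsP[k0 k0P]] imax.
pose good' m := (m \in A) && (dcoef m i \is a GRing.unit).
have [j /andP[jA uji] jmin] := arg_minP (fun m => x m) (k0P : good' k0).
have hi : in_circle (x i) := fpos_in_circle (p i).
have hj : in_circle (x j) := fpos_in_circle (p j).
have xij : x i <= x j.
  rewrite leNgt; apply/negP => lt_ji.
  have [b eb] := coef_dvd (h j ∘ d ∘ f i) hi hj lt_ji.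
  case/negP: (uniformizer_nonunit hR ht); apply/contraT => nt.
  by move: uji; rewrite /dcoef eb unitrM (negPf nt) andbF.
have hij : x i <= x j <= x i + 2 * pi.
  by case/andP: hi hj => ? ? /andP[? ?]; lra.
(* As [x j] is minimal, [dcoef l i] is divisible by [t] whenever
   [x l < x j], which is the condition to be a scalar [P x_j -> P x_l]. *)
have [m mE] : exists m : forall l, rhom (P t (cls (x j))) (P t (cls (x l))),
    forall l, l \in A -> coef (m l) = dcoef l i.
  have ex l' : exists m : rhom (P t (cls (x j))) (P t (cls (x l'))),
      l' \in A -> coef m = dcoef l' i.
    have [l'A|nl'] := boolP (l' \in A); last by exists 0.
    have [|m mE] := @coef_surj _ _ t (x j) (x l') (dcoef l' i) hj
      (fpos_in_circle _); last by exists m.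
    move=> lt; apply: (nonunit_dvd hR ht); apply/negP => ul'.
    by have := jmin l'; rewrite /good' l'A ul' leNgt lt => /(_ isT).
  by exists (fun l' => sval (cid (ex l'))) => l'; case: cid.
(* As [x i] is maximal, [dcoef j l] is divisible by [t] whenever
   [x i < x l], which is the condition to be a scalar [P x_l -> P x_i]. *)
have [k kE] : exists k : forall l, rhom (P t (cls (x l))) (P t (cls (x i))),
    forall l, l \in A -> coef (k l) = dcoef j l.
  have ex l' : exists k : rhom (P t (cls (x l'))) (P t (cls (x i))),
      l' \in A -> coef k = dcoef j l'.
    have [l'A|nl'] := boolP (l' \in A); last by exists 0.
    have [|k kE] := @coef_surj _ _ t (x l') (x i) (dcoef j l')
      (fpos_in_circle _) hi; last by exists k.
    move=> lt; apply: (nonunit_dvd hR ht); apply/negP => ul'.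
    have : x l' <= x i.
      by apply: imax; rewrite /good l'A; apply/existsP; exists j; rewrite jA.
    by rewrite leNgt lt.
  by exists (fun l' => sval (cid (ex l'))) => l'; case: cid.
pose w : rhom (P t (cls (x j))) X := \sum_(l in A) f l ∘ m l.
pose g1 : rhom X (P t (cls (x i))) := \sum_(l in A) k l ∘ h l.
pose al := alpha_star t hij; pose be := beta_star t hij.
have al_be : al ∘ be = rscale _ t.
  apply: (coef_inj t0); rewrite coef_comp coef_scale.
  by rewrite coef_alpha // coef_beta // mul1r.
have be_al : be ∘ al = rscale _ t.
  apply: (coef_inj t0); rewrite coef_comp coef_scale.
  by rewrite coef_alpha // coef_beta // mulr1.
have w_al : w ∘ al = d ∘ f i.
  rewrite [RHS](factor_sum _ pA) /w rhom_comp_suml; apply: eq_bigr => l' l'A.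
  rewrite -rhom_compA; congr (_ ∘ _); apply: (coef_inj t0).
  by rewrite coef_comp coef_alpha // mulr1 mE // rhom_compA.
have al_g1 : al ∘ g1 = h j ∘ d.
  rewrite [RHS](factor_sumr _ pA) /g1 rhom_comp_sumr; apply: eq_bigr => l' l'A.
  rewrite rhom_compA; congr (_ ∘ _); apply: (coef_inj t0).
  by rewrite coef_comp coef_alpha // mul1r kE.
(* The remaining commutations hold after multiplication by [t]. *)
have d_w : d ∘ w = f i ∘ be.
  apply: (torsion_free_rhom torsion_freeX); rewrite -rscale_nat -al_be.
  have -> : d ∘ w ∘ (al ∘ be) = d ∘ (w ∘ al) ∘ be by rewrite !rhom_compA.
  by rewrite w_al (rhom_compA d) Fpi_dd !rhom_compA.
have g1_d : g1 ∘ d = be ∘ h j.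
  apply: (torsion_free_rhom (@P_torsion_free _ _ _ t0 _)).
  have -> : rscale _ t ∘ (g1 ∘ d) = be ∘ (al ∘ g1) ∘ d.
    by rewrite -be_al !rhom_compA.
  by rewrite al_g1 -!rhom_compA Fpi_dd !rhom_compA rscale_nat !rhom_compA.
pose a : rhom (E t hij) X := rcopair (f i) w.
pose b : rhom X (E t hij) := rpair g1 (h j).
have aP : a \in @d_commuting _ _ _ (E t hij) X.
  apply/asboolP; apply: rhom_eq => s v.
  transitivity (f i s (be s v.2) + w s (al s v.1)).
    by have -> : (a ∘ Fpi_d (E t hij)) s v = a s (antidiag be al s v) by [];
      rewrite antidiagE.
  have := congr1 (fun q : rhom (P t (cls (x i))) X => q s v.1) w_al.
  have := congr1 (fun q : rhom (P t (cls (x j))) X => q s v.2) d_w.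
  rewrite /= => <- ->; rewrite [RHS]linearD; exact: addrC.
have bP : b \in @d_commuting _ _ _ X (E t hij).
  apply/asboolP; apply: rhom_eq => s v.
  have -> : (Fpi_d (E t hij) ∘ b) s v = antidiag be al s (b s v) by [].
  have -> : (b ∘ d) s v = b s (d s v) by [].
  rewrite antidiagE !rpairE.
  have := congr1 (fun q : rhom X (P t (cls (x i))) => q s v) g1_d.
  have := congr1 (fun q : rhom X (P t (cls (x j))) => q s v) al_g1.
  by rewrite /= => -> ->.
pose a' : hom (E t hij) X := FpiHom aP; pose b' : hom X (E t hij) := FpiHom bP.
have [u [_ bau]] : is_iso (compm b' a').
  apply/(E_iso_unit hR ht hi hj).
  have -> : (((compm b' a' : Fpi_hom _ _) : rhom _ _) base ((0, 1) : R * R)).2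
      = coef (h j ∘ w).
    have -> : ((compm b' a' : Fpi_hom _ _) : rhom _ _) base ((0, 1) : R * R) =
      b base (a base ((0, 1) : R * R)) by [].
    by rewrite rpairE /= linear0 add0r.
  suff <- : dcoef j i = coef (h j ∘ w) by [].
  rewrite /dcoef -rhom_compA -w_al rhom_compA coef_comp coef_alpha //.
  exact: mulr1.
exists (x i), (x j), hij, (compm a' u), b', j; split=> //.
  by rewrite compmA.
move=> Y q bq0.
have <- : rsnd _ _ ∘ (b ∘ (q : Fpi_hom Y X)) = h j ∘ (q : Fpi_hom Y X).
  by apply: rhom_eq => s v; rewrite /= add0r.
have -> : b ∘ (q : Fpi_hom Y X) = 0 :> rhom Y (E t hij).
  exact: (congr1 (@Fpi_fun _ _ _ _ _) bq0).
exact: rhom_comp0r.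
Qed.

End Splitting.

(** * Decomposition of objects *)

Section Decomposition.
Variables (RR : realType) (R : idomainType) (t : R).
Hypotheses (hR : is_dvr R) (ht : uniformizer t).

Definition is_E (X : Fpi RR t) : Prop :=
  exists (x y : RR) (hxy : x <= y <= x + 2 * pi),
    [/\ in_circle x, in_circle y & X = E t hxy].

Lemma is_E_local X : is_E X -> local_endomorphism_ring X.
Proof. by move=> [x [y [hxy [hx hy ->]]]]; apply: E_local. Qed.

Lemma zero_or_summand (X : Fpi RR t) (I : finType) (A : {set I})
    (p : I -> factor X) : factorization A p ->
  is_zero_object X \/
  exists Z Y, [/\ is_E Z, biproduct Z Y X
    & exists (B : {set I}) (q : I -> factor Y),
        (#|B| < #|A|)%N /\ factorization B q].
Proof.
have [n] := ubnP #|A|; elim: n A p => // n IHn A p ltAn pA.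
have [A0|[l lA]] := set_0Vmem A.
  left; apply/zero_objectP/Fpi_hom_eq; rewrite -[LHS]pA A0.
  by rewrite big1 // => l; rewrite inE.
have [ul|nul] := boolP (coef (fout (p l) ∘ fin (p l)) \is a GRing.unit);
  last first.
  have [q qA] := factorization_drop hR ht pA lA nul.
  have ltA : (#|A :\ l| < #|A|)%N by rewrite [ltnRHS](cardsD1 l) lA.
  have [|zX|[Z [Y [EZ ZY [B [r [ltB rB]]]]]]] := IHn _ q _ qA.
  - exact: leq_trans ltA ltAn.
  - by left.
  - right; exists Z, Y; split=> //; exists B, r; split=> //.
    exact: ltn_trans ltA.
right.
have [|x [y [hxy [a [b [j [hx hy jA ba kill]]]]]]] := E_split_mono hR ht pA.
  by exists l.
have [Y [k [q [qk bk qa e]]]] := Fpi_complement ba.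
exists (E t hxy), Y; split; first by exists x, y, hxy.
  by exists a, b, k, q.
have {}qk : (q : Fpi_hom X Y) ∘ (k : Fpi_hom Y X) = rhom_id Y :=
  congr1 (@Fpi_fun _ _ _ _ _) qk.
exists (A :\ j).
exists (fun m => factor_map (q : Fpi_hom X Y) (k : Fpi_hom Y X) (p m)).
split; first by rewrite [ltnRHS](cardsD1 j) jA.
rewrite /factorization -(factorization_retract qk pA) [RHS](big_setD1 j) //=.
by rewrite (kill _ _ bk) rhom_comp0r add0r.
Qed.

Lemma E_decomposition (X : Fpi RR t) :
  exists (J : finType) (Y : J -> Fpi RR t),
    is_direct_sum Y X /\ forall j, is_E (Y j).
Proof.
have [I [p pI]] := fg_projective_factorization (Fpi_fg X)
  (@Fpi_projective _ _ _ X).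
move: [set: I] pI => A; have [n] := ubnP #|A|.
elim: n X A p => // n IHn X A p ltAn pA.
have [zX|[Z [W [EZ ZW [B [q [ltB qB]]]]]]] := zero_or_summand pA.
  exists void, (fun v : void => match v with end); split; last by case.
  exact: is_direct_sum_void.
have [|J [Y [YW EY]]] := IHn W B q _ qB; first exact: leq_trans ltB ltAn.
exists (unit + J)%type, (fun i => match i with inl _ => Z | inr j => Y j end).
by split; [apply: is_direct_sum_cons YW | case].
Qed.

Lemma Fpi_krull_schmidt : krull_schmidt (Fpi RR t).
Proof.
split=> [|X]; first exact: Fpi_additive.
have [J [Y [YX EY]]] := E_decomposition X.
exists #|J|, (Y \o enum_val); split=> [|i]; last exact: is_E_local (EY _).
exact: is_direct_sum_reindex (@enum_val_bij J) YX.
Qed.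

Lemma indecomposable_iso_E (X : Fpi RR t) : indecomposable X ->
  exists2 Z, is_E Z & isomorphic X Z.
Proof.
move=> [nzX indX].
have [I [p pI]] := fg_projective_factorization (Fpi_fg X)
  (@Fpi_projective _ _ _ X).
have [//|[Z [W [EZ ZW _]]]] := zero_or_summand pI.
exists Z => //; have [/= zZ|/= zW] := indX _ (biproduct_is_direct_sum ZW).
  by have [] := is_E_local EZ; case; apply/zero_objectP.
exact: biproduct_zero_iso ZW zW.
Qed.

End Decomposition.

Theorem theorem2p2p4 (RR : realType) (R : idomainType) (t : R)
    (hR : is_dvr R) (ht : uniformizer t) :
  krull_schmidt (Fpi RR t) /\
  forall X : Fpi RR t,
    indecomposable X <->
    exists (x y : RR) (hxy : x <= y <= x + 2 * pi),
      [/\ 0 <= x, y < 2 * pi & isomorphic X (E t hxy)].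
Proof.
split=> [|X]; first exact: Fpi_krull_schmidt.
split=> [/(indecomposable_iso_E hR ht)[_ [x [y [hxy [hx hy ->]]]] isoX]|].
  by exists x, y, hxy; split=> //; [case/andP: hx | case/andP: hy].
move=> [x [y [hxy [x0 y2 isoX]]]].
apply: isomorphic_indecomposable isoX (local_indecomposable _).
have [xy _] := andP hxy.
apply: E_local => //; apply/andP; split=> //.
- exact: le_lt_trans xy y2.
- exact: le_trans x0 xy.
Qed.
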